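(* Let $K$ be a transition kernel on $(\Omega,\mathcal A)$ that is reversible with respect to the probability measure $\pi$ and lazy, and assume its conductance satisfies $\varphi(K,\pi)>0$. Let $\nu$ be a probability measure on $(\Omega,\mathcal A)$ having a bounded density $\frac{d\nu}{d\pi}$ with respect to $\pi$, and let $X_1,X_2,\dots$ be the Markov chain with transition kernel $K$ and initial distribution $\nu$. Let $f\in L_\infty(\Omega,\pi)$, $S(f)=\int_\Omega f(x)\,\pi(dx)$, and for integers $n\ge1$, $n_0\ge0$ let $S_{n,n_0}(f)=\frac1n\sum_{j=1}^n f(X_{j+n_0})$. If $$n_0\ge\frac{\log\left(\left\Vert\frac{d\nu}{d\pi}\right\Vert_\infty\right)}{\varphi(K,\pi)^2},$$ then $$e(S_{n,n_0},f)\le\frac{10}{\varphi(K,\pi)\cdot\sqrt n}\,\Vert f\Vert_\infty .$$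
   Context: $(\Omega,\mathcal A)$ is a countably generated measurable space. A transition kernel is a map $K:\Omega\times\mathcal A\to[0,1]$ such that $K(x,\cdot)$ is a probability measure for every $x\in\Omega$ and $K(\cdot,A)$ is $\mathcal A$-measurable for every $A\in\mathcal A$. $K$ is reversible with respect to $\pi$ if $\int_B K(x,A)\,\pi(dx)=\int_A K(x,B)\,\pi(dx)$ for all $A,B\in\mathcal A$ (so $\pi$ is stationary). $K$ is lazy if $K(x,\{x\})\ge 1/2$ for all $x\in\Omega$. The conductance is $$\varphi(K,\pi)=\inf_{0<\pi(A)\le 1/2}\frac{\int_A K(x,A^c)\,\pi(dx)}{\pi(A)},$$ the infimum being over $A\in\mathcal A$. Functions are real-valued and $\Vert\cdot\Vert_\infty$ is the norm of $L_\infty(\Omega,\pi)$. Convention for the chain: the starting point $X_0$ has distribution $\nu$ and $X_1,X_2,\dots$ are the subsequent states, so that $\mathbf E_{\nu,K}(f(X_i))=\int_\Omega P^i f(x)\,\nu(dx)$ and $\mathbf E_{\nu,K}(f(X_i)f(X_j))=\int_\Omega P^i\bigl(f\,P^{j-i}f\bigr)(x)\,\nu(dx)$ for $i\le j$, where $(Pf)(x)=\int_\Omega f(y)\,K(x,dy)$ and $\mathbf E_{\nu,K}$ denotes expectation for the chain with initial distribution $\nu$ and kernel $K$. The error is the root mean square error $e(S_{n,n_0},f)=\left(\mathbf E_{\nu,K}|S_{n,n_0}(f)-S(f)|^2\right)^{1/2}$. *)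

(* Defs.v *)
From HB Require Import structures.
From mathcomp Require Import all_boot all_order all_algebra.
From mathcomp Require Import all_classical all_reals all_analysis.

Set Implicit Arguments.
Unset Strict Implicit.
Unset Printing Implicit Defensive.

Import Order.TTheory GRing.Theory Num.Theory.
Import numFieldNormedType.Exports.

Local Open Scope classical_set_scope.
Local Open Scope ring_scope.
Local Open Scope ereal_scope.

Definition countably_generated (d : measure_display) (T : measurableType d) :=
  exists2 G : set (set T), countable G & @measurable d T = <<s G >>.

Section transition_kernels.
Context (R : realType) (d : measure_display) (T : measurableType d).
Implicit Types (K : R.-pker T ~> T) (pi : probability T R).

Definition reversible K pi := forall A B : set T,
  measurable A -> measurable B ->
  \int[pi]_(x in B) K x A = \int[pi]_(x in A) K x B.

(* A sigma-algebra need not contain the singletons, and [K x] is only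
   meaningful on measurable sets: writing K(x,{x}) presupposes that {x} is
   measurable. *)
Definition lazy_kernel K := forall x : T,
  measurable [set x] /\ (2^-1)%:E <= K x [set x].

(* The infimum of the empty set is +oo; this is the value when pi only takes
   the values 0 and 1. *)
Definition conductance K pi : \bar R :=
  ereal_inf [set (\int[pi]_(x in A) K x (~` A)) / pi A
            | A in [set A | [/\ measurable A, 0 < pi A & pi A <= (2^-1)%:E]]].

End transition_kernels.

Section markov_chains.
Context (R : realType) (d d' : measure_display).
Context (T : measurableType d) (W : measurableType d') (P : probability W R).
Implicit Types (X : nat -> {RV P >-> T}) (K : R.-pker T ~> T).

Definition history X (i : nat) : set (set W) :=
  <<s \bigcup_(j < i.+1) preimage_set_system setT (X j) measurable >>.

(* The second clause says that K(X_i, A) is a version of the conditional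
   probability of {X_{i+1} in A} given X_0, ..., X_i. *)
Definition markov_chain X (nu : probability T R) K :=
  (forall A : set T, measurable A -> distribution P (X 0%N) A = nu A) /\
  (forall (i : nat) (A : set T) (B : set W), measurable A -> history X i B ->
     P (B `&` X i.+1 @^-1` A) = \int[P]_(w in B) K (X i w) A).

Definition sample_mean X (f : T -> R) (n n0 : nat) (w : W) : R :=
  (n%:R^-1 * \sum_(1 <= j < n.+1) f (X (j + n0)%N w))%R.

Definition rmse (pi : probability T R) X (f : T -> R) (n n0 : nat) : \bar R :=
  sqrte 'E_P[fun w =>
    (`|sample_mean X f n n0 w - Rintegral pi setT f| ^+ 2)%R].

End markov_chains.

Definition density (R : realType) (d : measure_display) (T : measurableType d)
    (nu pi : probability T R) : T -> \bar R :=
  Radon_Nikodym (charge_of_finite_measure nu) pi.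

(* Main.v *)
Require Import Defs.
From HB Require Import structures.
From mathcomp Require Import all_boot all_order all_algebra.
From mathcomp Require Import all_classical all_reals all_analysis.
From mathcomp Require Import measurable_realfun ess_sup_inf.
From mathcomp Require Import ring lra.

Set Implicit Arguments.
Unset Strict Implicit.
Unset Printing Implicit Defensive.

Import Order.TTheory GRing.Theory Num.Theory.
Import numFieldNormedType.Exports.

Local Open Scope classical_set_scope.
Local Open Scope ring_scope.

(** Write P for the Markov operator (P h)(x) = \int h dK(x,.), which is
    self-adjoint in L2(pi) by reversibility, and let phi be the conductance.
    Three facts give the bound.

    Spectral gap.  The Cheeger inequality bounds <g, P g> by
    (1 - phi^2 / 2) <g, g> for g of mean zero ([cheeger_inequality]).  Laziness
    makes the form <g, P g> nonnegative ([markov_op_form_ge0]), so that it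
    satisfies a Cauchy-Schwarz inequality; this turns the bound on the form into
    the contraction |P g| <= lam |g| in L2(pi) with lam = 1 - phi^2 / 2
    ([mean_zero_contraction]).

    Covariances.  By the Markov property E(g(X_i) g(X_(i+k))) is the integral of
    P^i (g P^k g) against nu ([chain_lag], [chain_law]).  Split g P^k g into its
    mean, at most lam^k |g|^2 in absolute value, and a centred part, on which
    P^i contracts by lam^i.  A density bounded by M costs a factor sqrt M when
    integrating against nu ([int_le_L2norm_dominated]).  Since the hypothesis on
    n0 makes sqrt M lam^n0 at most 1 ([power_gap_le]), after the burn-in every
    covariance at lag k is at most D lam^k for one constant D
    ([chain_covariance_le]).

    Summation.  Geometric decay of the covariances bounds the mean square of the
    average by 2 D / (n (1 - lam)) = 4 D / (n phi^2) ([mean_square_error_le]).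
    With |f| <= B one has |g|_oo <= 2 B and |g|_2 <= B for the centred g, so
    D <= 3 B^2 and the error is at most sqrt 12 B / (phi sqrt n), which is
    below the bound with constant 10.

    All estimates are made for bounded measurable functions and real integrals.
    An essentially bounded f is first truncated at its essential supremum; the
    laws of all X_i are absolutely continuous with respect to pi, so that the
    truncation does not change the error ([rmse_truncate]). *)

(** * Layer-cake sums and integrals of bounded functions *)

Section layers.
Context (R : realType).
Implicit Types (e t : R) (N : nat).

(** The part of t below N e, rounded up to a multiple of e.  Summed along a
    function it is a combination of indicators of superlevel sets ([layersE]),
    and so a discrete form of the layer-cake formula. *)
Definition layers e N t := \sum_(k < N) e * (k%:R * e < t)%R%:R.

Lemma layers_ge e N t : 0 <= e -> t <= N%:R * e -> t <= layers e N t.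
Proof.
move=> e0 tN; suff: Num.min t (N%:R * e) <= layers e N t.
  by rewrite min_l.
rewrite /layers; elim: N {tN} => [|N IH].
  by rewrite big_ord0 mul0r ge_min lexx orbT.
rewrite big_ord_recr/=; have [Nt|tN] := ltP.
  rewrite mulr1 ge_min -natr1 mulrDl mul1r lerD2r.
  by move: IH; rewrite (min_r (ltW Nt)) => ->; rewrite orbT.
by move: IH; rewrite (min_l tN) mulr0 addr0 ge_min => ->.
Qed.

Lemma layers_le e N t : 0 <= e -> 0 <= t -> layers e N t <= t + e.
Proof.
move=> e0 t0; suff: layers e N t <= Num.min (N%:R * e) (t + e).
  by rewrite le_min => /andP[].
rewrite /layers; elim: N => [|N IH].
  by rewrite big_ord0 mul0r le_min lexx addr_ge0.
move: IH; rewrite big_ord_recr/= !le_min => /andP[IH1 IH2].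
have [Nt|tN] := ltP.
  by rewrite mulr1 -natr1 mulrDl; apply/andP; split; lra.
by rewrite mulr0 -natr1 mulrDl; apply/andP; split; lra.
Qed.

(** The indicators of superlevel sets are all ordered the same way at two
    points, so that their increments add up without cancellation. *)
Lemma layers_dist e N s t : 0 <= e -> 0 <= s <= N%:R * e -> 0 <= t <= N%:R * e ->
  \sum_(k < N) e * `|(k%:R * e < s)%R%:R - (k%:R * e < t)%R%:R| <= `|s - t| + e.
Proof.
move=> e0; wlog ts : s t / t <= s.
  move=> hw sN tN; have [/hw|/ltW st] := leP t s; first exact.
  by rewrite distrC; under eq_bigr do rewrite distrC; exact: hw.
move=> /andP[s0 sN] /andP[t0 tN]; rewrite ger0_norm ?subr_ge0//.
have -> : \sum_(k < N) e * `|(k%:R * e < s)%R%:R - (k%:R * e < t)%R%:R| =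
    layers e N s - layers e N t.
  rewrite /layers -sumrB; apply: eq_bigr => k _; rewrite -mulrBr ger0_norm//.
  by have [/lt_le_trans/(_ ts)->|] := ltP _ t; rewrite ?subrr// subr0 ler0n.
have := layers_le N e0 s0; have := layers_ge e0 tN; lra.
Qed.

Lemma layer_count e (C : R) : 0 < e -> exists N, C <= N%:R * e.
Proof.
move=> e0; exists (Num.bound `|C / e|); rewrite -ler_pdivrMr//.
by apply: le_trans (ler_norm _) (ltW _); apply: archi_boundP.
Qed.

Lemma layersE (T : Type) (h : T -> R) e N x :
  layers e N (h x) = \sum_(k < N) e * \1_[set y | k%:R * e < h y] x.
Proof. by apply: eq_bigr => k _; rewrite indicE mem_setE. Qed.

End layers.

Section bounded_measurable.
Context (R : realType) (d : measure_display) (T : measurableType d).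
Implicit Types (h : T -> R).

Definition bounded_measurable h :=
  measurable_fun setT h /\ exists C, forall x, `|h x| <= C.

Lemma bounded_measurable_cst (c : R) : bounded_measurable (fun=> c).
Proof. by split => //; exists `|c|. Qed.

Lemma bounded_measurable_indic (A : set T) : measurable A ->
  bounded_measurable \1_A.
Proof.
move=> mA; split; first exact: measurable_indic.
by exists 1 => x; rewrite indicE normr_nat lern1 leq_b1.
Qed.

Lemma bounded_measurableD h1 h2 : bounded_measurable h1 ->
  bounded_measurable h2 -> bounded_measurable (fun x => h1 x + h2 x).
Proof.
move=> [m1 [C1 b1]] [m2 [C2 b2]]; split; first exact: measurable_funD.
by exists (C1 + C2) => x; rewrite (le_trans (ler_normD _ _))// lerD.
Qed.

Lemma bounded_measurableM h1 h2 : bounded_measurable h1 ->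
  bounded_measurable h2 -> bounded_measurable (fun x => h1 x * h2 x).
Proof.
move=> [m1 [C1 b1]] [m2 [C2 b2]]; split; first exact: measurable_funM.
by exists (C1 * C2) => x; rewrite normrM ler_pM.
Qed.

Lemma bounded_measurableZ (c : R) h : bounded_measurable h ->
  bounded_measurable (fun x => c * h x).
Proof. by apply: bounded_measurableM; exact: bounded_measurable_cst. Qed.

Lemma bounded_measurableN h : bounded_measurable h ->
  bounded_measurable (fun x => - h x).
Proof.
by move=> [mh [C hC]]; split; [exact: measurableT_comp|exists C => x; rewrite normrN].
Qed.

Lemma bounded_measurableB h1 h2 : bounded_measurable h1 ->
  bounded_measurable h2 -> bounded_measurable (fun x => h1 x - h2 x).
Proof.
by move=> b1 b2; apply: bounded_measurableD => //; exact: bounded_measurableN.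
Qed.

Lemma bounded_measurable_sqr h : bounded_measurable h ->
  bounded_measurable (fun x => h x ^+ 2).
Proof. by move=> bh; exact: bounded_measurableM. Qed.

Lemma bounded_measurable_norm h : bounded_measurable h ->
  bounded_measurable (fun x => `|h x|).
Proof.
move=> [mh [C hC]]; split; first exact: measurableT_comp.
by exists C => x; rewrite normr_id.
Qed.

Lemma bounded_measurable_max0 h : bounded_measurable h ->
  bounded_measurable (fun x => Num.max (h x) 0).
Proof.
move=> [mh [C hC]]; split; first exact: measurable_maxr.
exists C => x; apply: le_trans (hC x).
by rewrite ger0_norm ?le_max ?lexx ?orbT// ge_max ler_norm normr_ge0.
Qed.

Lemma bounded_measurable_sum (I : Type) (s : seq I) (F : I -> T -> R) :
  (forall i, bounded_measurable (F i)) ->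
  bounded_measurable (fun x => \sum_(i <- s) F i x).
Proof.
move=> bF; elim: s => [|i s IH].
  by under eq_fun do rewrite big_nil; exact: bounded_measurable_cst.
by under eq_fun do rewrite big_cons; exact: bounded_measurableD.
Qed.

Lemma measurable_superlevel h (t : R) : measurable_fun setT h ->
  measurable [set x | t < h x].
Proof.
move=> mh; have := mh measurableT `]t, +oo[%classic (measurable_itv _).
rewrite setTI; congr measurable; apply/seteqP.
by split => x /=; rewrite in_itv/= andbT.
Qed.

(** Layer-cake sums of h + C, for a bound C of h, approximate it uniformly. *)
Lemma bounded_measurable_ind (Q : (T -> R) -> Prop) :
  (forall A, measurable A -> Q \1_A) ->
  (forall c h, bounded_measurable h -> Q h -> Q (fun x => c * h x)) ->
  (forall h1 h2, bounded_measurable h1 -> bounded_measurable h2 ->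
    Q h1 -> Q h2 -> Q (fun x => h1 x + h2 x)) ->
  (forall h, bounded_measurable h -> (forall e, 0 < e ->
    exists h', [/\ bounded_measurable h', Q h' &
                   forall x, `|h x - h' x| <= e]) -> Q h) ->
  forall h, bounded_measurable h -> Q h.
Proof.
move=> Q1 QZ QD Qlim h bh; apply: Qlim => // e e0.
have [mh [C hC]] := bh.
pose A k := [set x | k%:R * e < h x + C].
have mA k : measurable (A k).
  by apply: measurable_superlevel; exact: measurable_funD.
(* The layers need a nonnegative function, hence the shift of h by its bound. *)
have [N NC] := layer_count (2 * C) e0.
pose s x := \sum_(k < N) e * \1_(A k) x.
have [bs Qs] : bounded_measurable s /\ Q s.
  rewrite /s; elim: N {NC s} => [|n [IH1 IH2]].
    under eq_fun do rewrite big_ord0.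
    split; first exact: bounded_measurable_cst.
    have -> : (fun=> 0 : R) = (fun x : T => 0 * (\1_(@set0 T) x : R)).
      by apply/funext => x; rewrite mul0r.
    by apply: QZ; [exact: bounded_measurable_indic|exact: Q1].
  under eq_fun do rewrite big_ord_recr/=.
  have bA : bounded_measurable (\1_(A n) : T -> R) by exact: bounded_measurable_indic.
  split.
    by apply: bounded_measurableD => //; exact: bounded_measurableZ.
  apply: QD => //; first exact: bounded_measurableZ.
  by apply: QZ => //; exact: Q1.
have b1 : bounded_measurable (\1_(@setT T) : T -> R) by exact: bounded_measurable_indic.
exists (fun x => s x + - C * (\1_(@setT T) x : R)); split.
- by apply: bounded_measurableD => //; exact: bounded_measurableZ.
- apply: QD => //; first exact: bounded_measurableZ.
  by apply: QZ => //; exact: Q1.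
- move=> x; rewrite indicT/= /s -(layersE (fun x => h x + C)) mulr1.
  have := hC x; rewrite ler_norml => /andP[h1 h2].
  have := @layers_ge R e N (h x + C) (ltW e0).
  have := @layers_le R e N (h x + C) (ltW e0).
  move=> /(_ ltac:(lra)) l1 /(_ ltac:(lra)) l2.
  by rewrite ler_norml; apply/andP; split; lra.
Qed.

End bounded_measurable.

Lemma bounded_measurable_comp (R : realType) d (T : measurableType d)
    d' (W : measurableType d') (X : W -> T) (h : T -> R) :
  measurable_fun setT X -> bounded_measurable h -> bounded_measurable (h \o X).
Proof.
move=> mX [mh [C hC]]; split; first exact: measurableT_comp.
by exists C => w; exact: hC.
Qed.

Section integral_bounded.
Context (R : realType) (d : measure_display) (T : measurableType d).
Context (m : {measure set T -> \bar R}) (m1 : m setT = 1%E).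
Implicit Types (h : T -> R).

Lemma integrable_bm h : bounded_measurable h -> m.-integrable setT (EFin \o h).
Proof.
move=> [mh [C hC]]; apply: measurable_bounded_integrable => //.
  by rewrite m1 ltry.
exists C; split; first exact: num_real.
by move=> M CM x _; apply: le_trans (hC x) (ltW CM).
Qed.

Lemma intD h1 h2 : bounded_measurable h1 -> bounded_measurable h2 ->
  \int[m]_x (h1 x + h2 x) = \int[m]_x h1 x + \int[m]_x h2 x.
Proof. by move=> b1 b2; rewrite RintegralD//; exact: integrable_bm. Qed.

Lemma intB h1 h2 : bounded_measurable h1 -> bounded_measurable h2 ->
  \int[m]_x (h1 x - h2 x) = \int[m]_x h1 x - \int[m]_x h2 x.
Proof. by move=> b1 b2; rewrite RintegralB//; exact: integrable_bm. Qed.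

Lemma intZ c h : bounded_measurable h ->
  \int[m]_x (c * h x) = c * \int[m]_x h x.
Proof. by move=> b; rewrite RintegralZl//; exact: integrable_bm. Qed.

Lemma int_cst (c : R) : \int[m]_x c = c.
Proof. by rewrite Rintegral_cst// m1 mulr1. Qed.

Lemma int_sum (I : Type) (s : seq I) (F : I -> T -> R) :
  (forall i, bounded_measurable (F i)) ->
  \int[m]_x (\sum_(i <- s) F i x) = \sum_(i <- s) \int[m]_x F i x.
Proof.
move=> bF; elim: s => [|i s IH].
  under eq_Rintegral do rewrite big_nil; rewrite int_cst big_nil//.
under eq_Rintegral do rewrite big_cons.
by rewrite intD ?IH ?big_cons//; exact: bounded_measurable_sum.
Qed.

Lemma int_le h1 h2 : bounded_measurable h1 -> bounded_measurable h2 ->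
  (forall x, h1 x <= h2 x) -> \int[m]_x h1 x <= \int[m]_x h2 x.
Proof. by move=> b1 b2 le12; apply: le_Rintegral => //; exact: integrable_bm. Qed.

Lemma int_norm_le h C : bounded_measurable h -> (forall x, `|h x| <= C) ->
  `|\int[m]_x h x| <= C.
Proof.
move=> bh hC; have hN x : - C <= h x <= C by rewrite -ler_norml.
rewrite ler_norml; apply/andP; split.
- rewrite -[leLHS]int_cst; apply: int_le => //; first exact: bounded_measurable_cst.
  by move=> x; have /andP[] := hN x.
- rewrite -[leRHS]int_cst; apply: int_le => //; first exact: bounded_measurable_cst.
  by move=> x; have /andP[] := hN x.
Qed.

Lemma int_indic A : measurable A -> \int[m]_x \1_A x = fine (m A).
Proof. by move=> mA; rewrite /Rintegral integral_indic// setIT. Qed.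

Lemma int_sqr_ge0 h : 0 <= \int[m]_x (h x ^+ 2).
Proof. by apply: Rintegral_ge0 => x _; exact: sqr_ge0. Qed.

Lemma int_sqrD h1 h2 c : bounded_measurable h1 -> bounded_measurable h2 ->
  \int[m]_x ((h1 x + c * h2 x) ^+ 2) =
  \int[m]_x (h1 x ^+ 2) + 2 * c * \int[m]_x (h1 x * h2 x)
    + c ^+ 2 * \int[m]_x (h2 x ^+ 2).
Proof.
move=> b1 b2.
under eq_Rintegral.
  move=> x _.
  rewrite (_ : _ ^+ 2 = (h1 x ^+ 2 + (2 * c) * (h1 x * h2 x)) + c ^+ 2 * h2 x ^+ 2);
    last by ring.
  over.
have s1 := bounded_measurable_sqr b1; have s2 := bounded_measurable_sqr b2.
have p := bounded_measurableM b1 b2.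
by rewrite !intD ?intZ//; do ?[exact: bounded_measurableZ|
  apply: bounded_measurableD|exact: bounded_measurableZ].
Qed.

Lemma int_CauchySchwarz h1 h2 : bounded_measurable h1 -> bounded_measurable h2 ->
  (\int[m]_x (h1 x * h2 x)) ^+ 2
    <= \int[m]_x (h1 x ^+ 2) * \int[m]_x (h2 x ^+ 2).
Proof.
move=> b1 b2.
have q c : 0 <= \int[m]_x (h1 x ^+ 2) + 2 * c * \int[m]_x (h1 x * h2 x)
    + c ^+ 2 * \int[m]_x (h2 x ^+ 2).
  by rewrite -int_sqrD// int_sqr_ge0.
move: q (int_sqr_ge0 h1) (int_sqr_ge0 h2).
move: (\int[m]_x (h1 x * h2 x)) (\int[m]_x (h1 x ^+ 2)) (\int[m]_x (h2 x ^+ 2)).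
move=> b a c q a0 c0.
have [c00|c0'] := eqVneq c 0.
  have [->|bn0] := eqVneq b 0; first by rewrite expr0n/= mulr_ge0.
  have := q (- (a + 1) / (2 * b)); rewrite c00 mulr0 addr0.
  by rewrite (_ : 2 * _ * b = - (a + 1)); [lra|field].
(* The minimiser of the quadratic q. *)
have cp : 0 < c by rewrite lt0r c0' c0.
have := q (- b / c).
rewrite (_ : _ + _ = (a * c - b ^+ 2) / c); last by field; exact: lt0r_neq0.
by rewrite pmulr_lge0 ?invr_gt0// subr_ge0.
Qed.

Lemma int_sqr_le h : bounded_measurable h ->
  (\int[m]_x h x) ^+ 2 <= \int[m]_x (h x ^+ 2).
Proof.
move=> bh; have := int_CauchySchwarz bh (bounded_measurable_cst T 1).
rewrite expr1n int_cst mulr1.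
by under [X in X ^+ 2 <= _ -> _]eq_Rintegral do rewrite mulr1.
Qed.

End integral_bounded.

(** * The Markov operator of a kernel *)

Section linear_extension.
Context (R : realType) (d d' : measure_display).
Context (T : measurableType d) (W : measurableType d').

(** The operators used below: composition with a random variable, the Markov
    operator, and their compositions and iterates.  Contraction is meant in the
    supremum norm. *)
Definition linear_contraction (F : (T -> R) -> (W -> R)) :=
  [/\ forall h, bounded_measurable h -> bounded_measurable (F h),
      forall c h, bounded_measurable h ->
        F (fun x => c * h x) = (fun w => c * F h w),
      forall h1 h2, bounded_measurable h1 -> bounded_measurable h2 ->
        F (fun x => h1 x + h2 x) = (fun w => F h1 w + F h2 w) &
      forall h e, bounded_measurable h -> (forall x, `|h x| <= e) ->
        forall w, `|F h w| <= e].

Lemma linear_contraction_comp_fun (X : W -> T) : measurable_fun setT X ->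
  linear_contraction (fun h => h \o X).
Proof.
move=> mX; split => //; first by move=> h; exact: bounded_measurable_comp.
by move=> h e _ he w; exact: he.
Qed.

Definition bounded_linear (L : (T -> R) -> R) :=
  [/\ forall c h, bounded_measurable h -> L (fun x => c * h x) = c * L h,
      forall h1 h2, bounded_measurable h1 -> bounded_measurable h2 ->
        L (fun x => h1 x + h2 x) = L h1 + L h2 &
      exists2 C, 0 <= C & forall h e, bounded_measurable h ->
        (forall x, `|h x| <= e) -> `|L h| <= C * e].

Lemma bounded_linear_int (m : {measure set W -> \bar R}) (m1 : m setT = 1%E)
    (a : W -> R) (F : (T -> R) -> (W -> R)) :
  bounded_measurable a -> linear_contraction F ->
  bounded_linear (fun h => \int[m]_w (a w * F h w)).
Proof.
move=> ba [Fbm FZ FD FC]; split.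
- move=> c h bh; rewrite FZ// -intZ//.
    by apply: eq_Rintegral => w _; ring.
  by apply: bounded_measurableM => //; exact: Fbm.
- move=> h1 h2 b1 b2; rewrite FD// -intD//.
  + by apply: eq_Rintegral => w _; rewrite mulrDr.
  + by apply: bounded_measurableM => //; exact: Fbm.
  + by apply: bounded_measurableM => //; exact: Fbm.
- have [ma [C aC]] := ba; exists `|C|; first by [].
  move=> h e bh he; apply: int_norm_le => //.
    by apply: bounded_measurableM => //; exact: Fbm.
  move=> w; rewrite normrM ler_pM// ?FC//.
  by rewrite (le_trans (aC w))// ler_norm.
Qed.

(** Identities between integrals of bounded functions thus reduce to identities
    between measures of sets. *)
Lemma bounded_linear_ext (L1 L2 : (T -> R) -> R) :
  bounded_linear L1 -> bounded_linear L2 ->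
  (forall A, measurable A -> L1 \1_A = L2 \1_A) ->
  forall h, bounded_measurable h -> L1 h = L2 h.
Proof.
move=> [Z1 D1 [C1 C10 B1]] [Z2 D2 [C2 C20 B2]] L12.
apply: bounded_measurable_ind => //.
- by move=> c h bh Lh; rewrite Z1// Z2// Lh.
- by move=> h1 h2 b1 b2 Lh1 Lh2; rewrite D1// D2// Lh1 Lh2.
move=> h bh happrox.
have split_at L h' : (forall c h, bounded_measurable h ->
      L (fun x => c * h x) = c * L h) ->
    (forall h1 h2, bounded_measurable h1 -> bounded_measurable h2 ->
      L (fun x => h1 x + h2 x) = L h1 + L h2) ->
    bounded_measurable h' -> L h = L (fun x => h x - h' x) + L h'.
  move=> LZ LD bh'; rewrite -LD//; last exact: bounded_measurableB.
  by congr L; apply/funext => x; rewrite subrK.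
apply/eqP; rewrite -subr_eq0 -normr_eq0 eq_le normr_ge0 andbT.
apply/ler_addgt0Pr => e e0; rewrite add0r.
have C0 : 0 < C1 + C2 + 1 by lra.
have [h' [bh' Lh' hh']] := happrox (e / (C1 + C2 + 1)) (divr_gt0 e0 C0).
rewrite (split_at L1 h')// (split_at L2 h')// Lh' opprD addrACA subrr addr0.
have bhh' := bounded_measurableB bh bh'.
apply: le_trans (ler_normB _ _) _.
apply: le_trans (lerD (B1 _ _ bhh' hh') (B2 _ _ bhh' hh')) _.
rewrite -mulrDl mulrA ler_pdivrMr// mulrC ler_wpM2l ?ltW//; lra.
Qed.

End linear_extension.

Lemma linear_contraction_id (R : realType) d (T : measurableType d) :
  linear_contraction (fun h : T -> R => h).
Proof. by split => // h e _ he; exact: he. Qed.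

Lemma linear_contraction_comp (R : realType) d1 d2 d3 (T1 : measurableType d1)
    (T2 : measurableType d2) (T3 : measurableType d3)
    (F : (T1 -> R) -> (T2 -> R)) (G : (T2 -> R) -> (T3 -> R)) :
  linear_contraction F -> linear_contraction G -> linear_contraction (G \o F).
Proof.
move=> [Fb FZ FD FC] [Gb GZ GD GC]; split => /=.
- by move=> h bh; exact/Gb/Fb.
- by move=> c h bh; rewrite FZ// GZ//; exact: Fb.
- by move=> h1 h2 b1 b2; rewrite FD// GD//; exact: Fb.
- by move=> h e bh he; apply: GC; [exact: Fb|exact: FC].
Qed.

Section markov_operator.
Context (R : realType) (d : measure_display) (T : measurableType d).
Context (K : R.-pker T ~> T).
Implicit Types (a b h u : T -> R).

Definition markov_op h : T -> R := fun x => \int[K x]_y h y.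
Local Notation P := markov_op.

Let K1 x : K x setT = 1%E. Proof. exact: prob_kernel. Qed.

Lemma markov_op_bm h : bounded_measurable h -> bounded_measurable (P h).
Proof.
move=> bh; have [mh [C hC]] := bh; split; last first.
  by exists C => x; exact: int_norm_le.
have bC := bounded_measurable_cst T C.
(* Kernel integrals are known to be measurable for nonnegative integrands. *)
have -> : P h = (fun x => fine (\int[K x]_y (h y + C)%:E)%E - C).
  apply/funext => x; rewrite -/(Rintegral (K x) setT (fun y => h y + C)).
  by rewrite intD// int_cst// addrK.
apply: measurable_funB => //; apply: measurableT_comp => //.
apply: measurable_fun_integral_kernel.
- by move=> U mU; exact: measurable_kernel.
- by move=> y; rewrite lee_fin; have := hC y; rewrite ler_norml => /andP[]; lra.
- by apply/measurable_EFinP; exact: measurable_funD.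
Qed.

Lemma linear_contraction_markov_op : linear_contraction P.
Proof.
split; first exact: markov_op_bm.
- by move=> c h bh; apply/funext => x; rewrite /P intZ.
- by move=> h1 h2 b1 b2; apply/funext => x; rewrite /P intD.
- by move=> h e bh he x; exact: int_norm_le.
Qed.

Lemma markov_op_indic A x : measurable A -> P \1_A x = fine (K x A).
Proof. by move=> mA; rewrite /P int_indic. Qed.

Lemma markov_op_cst (c : R) : P (fun=> c) = fun=> c.
Proof. by apply/funext => x; rewrite /P int_cst. Qed.

Lemma markov_opB h1 h2 : bounded_measurable h1 -> bounded_measurable h2 ->
  P (fun x => h1 x - h2 x) = fun x => P h1 x - P h2 x.
Proof. by move=> b1 b2; apply/funext => x; rewrite /P intB. Qed.

Lemma markov_op_sqrD u c x : bounded_measurable u ->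
  \int[K x]_y ((u x + c * u y) ^+ 2) =
  u x ^+ 2 + 2 * c * (u x * P u x) + c ^+ 2 * P (fun y => u y ^+ 2) x.
Proof.
move=> bu; rewrite (int_sqrD (K1 x) c (bounded_measurable_cst T (u x)) bu).
by rewrite int_cst// intZ.
Qed.

Section reversible.
Context (pi : probability T R) (Krev : reversible K pi).

Let pi1 : pi setT = 1%E. Proof. exact: probability_setT. Qed.

Lemma kernel_fin x A : measurable A -> K x A \is a fin_num.
Proof.
move=> mA; rewrite ge0_fin_numE//; apply: (@le_lt_trans _ _ 1%E); last exact: ltry.
by rewrite -(K1 x); apply: le_measure; rewrite ?inE.
Qed.

(** The flow from B to A in a single step of the stationary chain. *)
Lemma int_indic_markov_op A B : measurable A -> measurable B ->
  (\int[pi]_x (\1_B x * P \1_A x))%:E = (\int[pi]_(x in B) K x A)%E.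
Proof.
move=> mA mB.
have bB : bounded_measurable (\1_B : T -> R) by exact: bounded_measurable_indic.
have bA : bounded_measurable (P \1_A) by apply/markov_op_bm/bounded_measurable_indic.
rewrite /Rintegral fineK; last first.
  by apply: integrable_fin_num => //; apply: integrable_bm => //; exact: bounded_measurableM.
rewrite [RHS]integral_mkcond; apply: eq_integral => x _.
rewrite patchE indicE; case: ifPn => xB.
  by rewrite mul1r markov_op_indic// fineK// kernel_fin.
by rewrite mul0r.
Qed.

(** Reversibility is this identity for indicators; it extends to each argument
    in turn. *)
Lemma markov_op_sym a b : bounded_measurable a -> bounded_measurable b ->
  \int[pi]_x (a x * P b x) = \int[pi]_x (b x * P a x).
Proof.
have comm f g : \int[pi]_x (f x * g x) = \int[pi]_x (g x * f x).
  by apply: eq_Rintegral => x _; rewrite mulrC.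
move=> ba; move: b.
apply: (bounded_linear_ext (L1 := fun h => \int[pi]_x (a x * P h x))
  (L2 := fun h => \int[pi]_x (h x * P a x))).
- by apply: bounded_linear_int => //; exact: linear_contraction_markov_op.
- under eq_fun do rewrite comm.
  exact: (bounded_linear_int pi1 (markov_op_bm ba) (linear_contraction_id R T)).
move=> A mA; have bA : bounded_measurable (\1_A : T -> R).
  exact: bounded_measurable_indic.
move: a ba.
apply: (bounded_linear_ext (L1 := fun h => \int[pi]_x (h x * P \1_A x))
  (L2 := fun h => \int[pi]_x (\1_A x * P h x))).
- under eq_fun do rewrite comm.
  exact: (bounded_linear_int pi1 (markov_op_bm bA) (linear_contraction_id R T)).
- by apply: bounded_linear_int => //; exact: linear_contraction_markov_op.
- move=> B mB; apply: EFin_inj.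
  by rewrite !int_indic_markov_op//; exact: Krev.
Qed.

Lemma markov_op_stationary h : bounded_measurable h ->
  \int[pi]_x P h x = \int[pi]_x h x.
Proof.
move=> bh; have := markov_op_sym (bounded_measurable_cst T 1) bh.
rewrite markov_op_cst.
under eq_Rintegral do rewrite mul1r.
by under [X in _ = X -> _]eq_Rintegral do rewrite mulr1.
Qed.

(** For c = -1 this is twice the Dirichlet form of u, for c = 1 its counterpart
    with a sum in place of the difference. *)
Lemma int_int_sqrD u c : bounded_measurable u ->
  \int[pi]_x (\int[K x]_y ((u x + c * u y) ^+ 2)) =
  (1 + c ^+ 2) * \int[pi]_x (u x ^+ 2) + 2 * c * \int[pi]_x (u x * P u x).
Proof.
move=> bu; have bu2 := bounded_measurable_sqr bu.
have bPu := bounded_measurableM bu (markov_op_bm bu).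
under eq_Rintegral do rewrite markov_op_sqrD//.
have := markov_op_bm bu2 => bPu2.
rewrite !intD//.
- rewrite !intZ// markov_op_stationary//; ring.
- exact: bounded_measurableZ.
- by apply: bounded_measurableD => //; exact: bounded_measurableZ.
- exact: bounded_measurableZ.
Qed.

Lemma markov_op_form_le u : bounded_measurable u ->
  \int[pi]_x (u x * P u x) <= \int[pi]_x (u x ^+ 2).
Proof.
move=> bu; have := int_int_sqrD (-1) bu.
have : 0 <= \int[pi]_x (\int[K x]_y ((u x + -1 * u y) ^+ 2)).
  by apply: Rintegral_ge0 => x _; exact: int_sqr_ge0.
by move=> + eq; rewrite eq; lra.
Qed.

(** The chain stays at x with probability at least 1/2, and there
    (u x + u y)^2 = 4 (u x)^2, so that the inner integral of (u x + u y)^2 is at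
    least 2 (u x)^2. *)
Lemma markov_op_form_ge0 u : lazy_kernel K -> bounded_measurable u ->
  0 <= \int[pi]_x (u x * P u x).
Proof.
move=> Klazy bu; have := int_int_sqrD 1 bu.
suff : 2 * \int[pi]_x (u x ^+ 2) <=
    \int[pi]_x (\int[K x]_y ((u x + 1 * u y) ^+ 2)).
  by move=> + eq; rewrite eq; lra.
have bu2 := bounded_measurable_sqr bu.
rewrite -intZ//; apply: int_le => //; first exact: bounded_measurableZ.
  have bPu := bounded_measurableM bu (markov_op_bm bu).
  under eq_fun do rewrite markov_op_sqrD//.
  apply: bounded_measurableD; last exact/bounded_measurableZ/markov_op_bm.
  by apply: bounded_measurableD => //; exact: bounded_measurableZ.
move=> x; have [mx Kx] := Klazy x.
have bx : bounded_measurable (\1_[set x] : T -> R) by exact: bounded_measurable_indic.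
have Kx' : 2^-1 <= fine (K x [set x]).
  by rewrite -lee_fin fineK// kernel_fin.
apply: (@le_trans _ _ (\int[K x]_y ((4 * u x ^+ 2) * \1_[set x] y))).
  rewrite intZ// int_indic//; have := sqr_ge0 (u x); nra.
apply: int_le => //; first exact: bounded_measurableZ.
  apply/bounded_measurable_sqr/bounded_measurableD.
    exact: bounded_measurable_cst.
  exact: bounded_measurableZ.
move=> y; rewrite indicE; have [/set_mem/= ->|_] := boolP (y \in [set x]).
  by rewrite mulr1 mul1r (_ : (u x + u x) ^+ 2 = 4 * u x ^+ 2)//; ring.
by rewrite mulr0 sqr_ge0.
Qed.

End reversible.
End markov_operator.

(** * The Cheeger inequality and contraction of mean-zero functions *)

Section median.
Context (R : realType) (d : measure_display) (T : measurableType d).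
Context (pi : probability T R).
Implicit Types (h : T -> R).

Lemma superlevel_le_right h (t : R) (c : \bar R) : measurable_fun setT h ->
  (forall n, (pi [set x | (t + n.+1%:R^-1 < h x)%R] <= c)%E) ->
  (pi [set x | (t < h x)%R] <= c)%E.
Proof.
move=> mh le_c; pose F n := [set x | t + n.+1%:R^-1 < h x].
have mF n : measurable (F n) by exact: measurable_superlevel.
have -> : [set x | t < h x] = \bigcup_n F n.
  apply/seteqP; split => x /=; last first.
    by move=> [n _]; apply: lt_trans; rewrite ltrDl invr_gt0.
  rewrite -subr_gt0 => tx.
  exists (Num.bound (h x - t)^-1) => //; rewrite /F/= -ltrBrDl.
  rewrite invf_plt ?posrE//; apply: (@lt_trans _ _ (Num.bound (h x - t)^-1)%:R).
    by apply: archi_boundP; rewrite invr_ge0 ltW.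
  by rewrite ltr_nat.
have cvgF : pi (F n) @[n --> \oo] --> pi (\bigcup_n F n).
  apply: nondecreasing_cvg_mu => //; first exact: bigcup_measurable.
  move=> m n mn; apply/subsetPset => x; rewrite /F/=; apply: le_lt_trans.
  by rewrite lerD2l lef_pV2 ?posrE// ler_nat.
rewrite -(cvg_lim _ cvgF)//; apply: lime_le; last exact: nearW.
by apply/cvg_ex; eexists; exact: cvgF.
Qed.

Lemma median_exists h : bounded_measurable h -> exists t : R,
  (pi [set x | (t < h x)%R] <= 2^-1%:E)%E /\
  (pi [set x | (h x < t)%R] <= 2^-1%:E)%E.
Proof.
move=> [mh [C hC]].
(* The median is the infimum of the levels that h exceeds with probability
   at most one half. *)
pose S := [set t | (pi [set x | (t < h x)%R] <= 2^-1%:E)%E].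
have hCx x : - C <= h x <= C by rewrite -ler_norml.
have SC : S C.
  rewrite /S/= (_ : [set x | _] = set0) ?measure0 ?lee_fin ?invr_ge0//.
  by apply/seteqP; split => x //=; have /andP[_] := hCx x; rewrite leNgt => /negP.
have lbS : lbound S (- C).
  move=> t; rewrite /S/= => St; rewrite leNgt; apply/negP => tC; move: St.
  rewrite (_ : [set x | _] = setT); last first.
    apply/seteqP; split => x //= _; apply: lt_le_trans tC _.
    by have /andP[] := hCx x.
  by rewrite probability_setT lee_fin => ?; lra.
have hasS : has_inf S by split; [exists C|exists (- C)].
exists (inf S); split.
  apply: superlevel_le_right => // n.
  have n0 : (0 : R) < n.+1%:R^-1 by rewrite invr_gt0.
  have [t St tlt] := inf_adherent n0 hasS.
  apply: le_trans St; apply: le_measure; rewrite ?inE; try exact: measurable_superlevel.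
  by move=> x /=; exact: lt_trans.
rewrite (_ : [set x | _] = [set x | - inf S < - h x]); last first.
  by apply/seteqP; split => x /=; rewrite ltrN2.
have mNh : measurable_fun setT (fun x => - h x) by exact: measurableT_comp.
apply: superlevel_le_right => // n.
have n0 : (0 : R) < n.+1%:R^-1 by rewrite invr_gt0.
set t := inf S - n.+1%:R^-1.
have tS : ~ S t.
  by move=> St; have := ge_inf hasS.2 St; apply/negP; rewrite -ltNge gtrBl.
have /negP := tS; rewrite /S/= -ltNge => tlt.
apply: (@le_trans _ _ (pi (~` [set x | t < h x]))).
  apply: le_measure; rewrite ?inE.
  - exact: measurable_superlevel.
  - by apply: measurableC; exact: measurable_superlevel.
  - move=> x /= hx; apply/negP; rewrite -leNgt /t.
    by rewrite -lerN2 opprB addrC ltW.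
rewrite probability_setC; last exact: measurable_superlevel.
rewrite leeBlDr ?fin_num_measure//; last exact: measurable_superlevel.
apply: le_trans (leeD2l _ (ltW tlt)).
by rewrite -EFinD lee_fin; lra.
Qed.

End median.

(** This is how the inequality for |u x^2 - u y^2| closes in
    [cheeger_half_support]: n is |u|^2 and q is <u, P u>. *)
Lemma cheeger_arith (R : realFieldType) (phi n q : R) : 0 < phi -> q <= n ->
  2 * phi * n <= phi^-1 * (2 * n - 2 * q) + phi / 4 * (2 * n + 2 * q) ->
  phi ^+ 2 / 2 * n <= n - q.
Proof.
move=> phi0 qn main.
have : phi * n <= phi^-1 * (2 * n - 2 * q).
  have : phi / 4 * (2 * n + 2 * q) <= phi * n by nra.
  lra.
move=> /(ler_wpM2l (ltW phi0)); rewrite [leRHS]mulrA mulfV ?gt_eqF// mul1r; nra.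
Qed.

Section cheeger.
Context (R : realType) (d : measure_display) (T : measurableType d).
Context (K : R.-pker T ~> T) (pi : probability T R).
Context (Krev : reversible K pi).
Implicit Types (a b h u g : T -> R).
Local Notation P := (markov_op K).

Let pi1 : pi setT = 1%E. Proof. exact: probability_setT. Qed.
Let K1 x : K x setT = 1%E. Proof. exact: prob_kernel. Qed.

(** A real lower bound of the conductance.  Sets of measure zero are admitted,
    since they satisfy the inequality trivially, and phi may be any real when the
    conductance is infinite. *)
Definition isoperimetric (phi : R) := forall A, measurable A ->
  (pi A <= (2^-1)%:E)%E ->
  phi * fine (pi A) <= \int[pi]_x (\1_A x * P \1_(~` A) x).

Lemma markov_op_cut A x : measurable A ->
  \1_A x * P \1_(~` A) x + \1_(~` A) x * P \1_A x =
  \int[K x]_y `|(\1_A x : R) - \1_A y|.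
Proof.
move=> mA; have bA : bounded_measurable (\1_A : T -> R).
  exact: bounded_measurable_indic.
have bAc : bounded_measurable (\1_(~` A) : T -> R).
  by apply: bounded_measurable_indic; exact: measurableC.
have IC y : \1_(~` A) y = 1 - \1_A y :> R.
  by rewrite !indicE in_setC; case: (y \in A); rewrite ?subrr ?subr0.
rewrite -!intZ// -intD//; try exact: bounded_measurableZ.
apply: eq_Rintegral => y _; rewrite !IC !indicE.
by case: (x \in A); case: (y \in A);
  rewrite /= ?subrr ?subr0 ?sub0r ?mul1r ?mul0r ?addr0 ?add0r ?normrN ?normr0 ?normr1.
Qed.

(** The superlevel sets of u^2 have measure at most 1/2, so that the isoperimetric
    inequality applies to each of them.  Adding up the layers bounds
    2 phi |u|^2 by the mean of |u x^2 - u y^2| over consecutive states, and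
    |u x^2 - u y^2| = |u x - u y| (u x + u y) is split by the inequality of
    arithmetic and geometric means. *)
Lemma cheeger_half_support (phi : R) u : 0 < phi -> isoperimetric phi ->
  bounded_measurable u -> (forall x, 0 <= u x) ->
  (pi [set x | (0 < u x)%R] <= (2^-1)%:E)%E ->
  phi ^+ 2 / 2 * \int[pi]_x (u x ^+ 2) <=
  \int[pi]_x (u x ^+ 2) - \int[pi]_x (u x * P u x).
Proof.
move=> phi0 iso bu u0 usupp.
have bu2 := bounded_measurable_sqr bu.
have bdiff x c : bounded_measurable (fun y => (u x + c * u y) ^+ 2).
  apply/bounded_measurable_sqr/bounded_measurableD; first exact: bounded_measurable_cst.
  exact: bounded_measurableZ.
have bidiff c : bounded_measurable (fun x => \int[K x]_y ((u x + c * u y) ^+ 2)).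
  under eq_fun do rewrite markov_op_sqrD//.
  apply: bounded_measurableD; last exact/bounded_measurableZ/markov_op_bm.
  apply: bounded_measurableD => //; apply: bounded_measurableZ.
  by apply: bounded_measurableM => //; exact: markov_op_bm.
set N2 := \int[pi]_x (u x ^+ 2); set PU := \int[pi]_x (u x * P u x).
(* The sum over layers overshoots each increment by at most e. *)
suff main e : 0 < e -> 2 * phi * N2 <=
    phi^-1 * (2 * N2 - 2 * PU) + phi / 4 * (2 * N2 + 2 * PU) + e.
  apply: cheeger_arith => //; first exact: markov_op_form_le.
  by apply/ler_addgt0Pr => e e0; exact: main.
move=> e0.
have [mu [C uC]] := bu.
have u2C x : u x ^+ 2 <= C ^+ 2.
  by have := uC x; rewrite ger0_norm// => ?; rewrite ler_sqr ?nnegrE// (le_trans (u0 x)).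
have [N NC] := layer_count (C ^+ 2) e0.
pose A k := [set x | k%:R * e < u x ^+ 2].
have mA k : measurable (A k) by apply: measurable_superlevel; exact: bu2.1.
have AE k x : \1_(A k) x = (k%:R * e < u x ^+ 2)%R%:R :> R.
  by rewrite indicE /A mem_setE.
have bA k : bounded_measurable (\1_(A k) : T -> R) by exact: bounded_measurable_indic.
have bAc k : bounded_measurable (\1_(~` A k) : T -> R).
  by apply: bounded_measurable_indic; exact: measurableC.
have piA k : (pi (A k) <= (2^-1)%:E)%E.
  apply: le_trans usupp; apply: le_measure; rewrite ?inE//.
    exact: measurable_superlevel.
  move=> x; rewrite /A/= => kx; rewrite lt0r u0 andbT.
  apply/eqP => ux0; move: kx; rewrite ux0 expr0n/= ltNge mulr_ge0//.
  exact: ltW.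
pose cut k x : R := \int[K x]_y `|(\1_(A k) x : R) - \1_(A k) y|.
have cutE k x : cut k x = \1_(A k) x * P \1_(~` A k) x + \1_(~` A k) x * P \1_(A k) x.
  by rewrite markov_op_cut.
have bcut k : bounded_measurable (cut k).
  rewrite (funext (cutE k)).
  by apply: bounded_measurableD; apply: bounded_measurableM => //; exact: markov_op_bm.
(* By reversibility the flows out of and into A k are equal: this is where the
   factor 2 comes from. *)
have iso_cut k : 2 * phi * fine (pi (A k)) <= \int[pi]_x cut k x.
  under eq_Rintegral do rewrite cutE.
  rewrite intD//; try by apply: bounded_measurableM => //; exact: markov_op_bm.
  rewrite [X in _ + X](markov_op_sym Krev)//.
  by have := iso _ (mA k) (piA k); lra.
have N2_le : N2 <= \sum_(k < N) e * fine (pi (A k)).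
  rewrite /N2; apply: (@le_trans _ _ (\int[pi]_x (\sum_(k < N) e * \1_(A k) x))).
    apply: int_le => //.
      by apply: bounded_measurable_sum => k; exact: bounded_measurableZ.
    move=> x; rewrite -(layersE (fun x => u x ^+ 2)).
    by apply: layers_ge; [exact: ltW|exact: le_trans (u2C x) NC].
  rewrite int_sum//; last by move=> k; exact: bounded_measurableZ.
  by apply: ler_sum => k _; rewrite intZ// int_indic.
have sum_cut : 2 * phi * N2 <= \int[pi]_x (\sum_(k < N) e * cut k x).
  rewrite int_sum//; last by move=> k; exact: bounded_measurableZ.
  apply: le_trans (ler_wpM2l _ N2_le) _; first by rewrite mulr_ge0// ltW.
  rewrite mulr_sumr; apply: ler_sum => k _; rewrite intZ// mulrCA.
  by rewrite ler_wpM2l// ltW.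
apply: le_trans sum_cut _.
apply: (@le_trans _ _ (\int[pi]_x (phi^-1 * \int[K x]_y ((u x + -1 * u y) ^+ 2)
    + phi / 4 * \int[K x]_y ((u x + 1 * u y) ^+ 2) + e))).
  apply: int_le => //.
  - by apply: bounded_measurable_sum => k; exact: bounded_measurableZ.
  - apply: bounded_measurableD; last exact: bounded_measurable_cst.
    by apply: bounded_measurableD; exact: bounded_measurableZ.
  move=> x.
  have bcutx k : bounded_measurable (fun y => `|(\1_(A k) x : R) - \1_(A k) y|).
    apply/bounded_measurable_norm/bounded_measurableB => //.
    exact: bounded_measurable_cst.
  have -> : \sum_(k < N) e * cut k x =
      \int[K x]_y (\sum_(k < N) e * `|(\1_(A k) x : R) - \1_(A k) y|).
    rewrite int_sum//; last by move=> k; exact: bounded_measurableZ.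
    by apply: eq_bigr => k _; rewrite intZ.
  rewrite -!intZ// -[X in _ + X](int_cst (K1 x)) -!intD//;
    do ?[exact: bounded_measurableZ|exact: bounded_measurable_cst
        |apply: bounded_measurableD]; try exact: bounded_measurableZ.
  apply: int_le => //.
  - by apply: bounded_measurable_sum => k; exact: bounded_measurableZ.
  - apply: bounded_measurableD; last exact: bounded_measurable_cst.
    by apply: bounded_measurableD; exact: bounded_measurableZ.
  move=> y; under eq_bigr do rewrite !AE.
  apply: le_trans (layers_dist (ltW e0) _ _) _.
  - by rewrite sqr_ge0 (le_trans (u2C x)).
  - by rewrite sqr_ge0 (le_trans (u2C y)).
  rewrite lerD2r.
  (* The weight is optimal for the final bound, where the second square
     contributes half of the left-hand side. *)
  have amgm p q : p * q <= phi^-1 * p ^+ 2 + phi / 4 * q ^+ 2.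
    rewrite -subr_ge0 (_ : _ - _ = phi^-1 * (p - phi / 2 * q) ^+ 2).
      by rewrite mulr_ge0 ?sqr_ge0// invr_ge0 ltW.
    by field; exact: lt0r_neq0.
  rewrite subr_sqr normrM (ger0_norm (addr_ge0 (u0 x) (u0 y))).
  apply: le_trans (amgm _ _) _; rewrite real_normK ?num_real//.
  by rewrite mulN1r mul1r.
rewrite !intD//; do ?[exact: bounded_measurableZ|exact: bounded_measurable_cst
        |apply: bounded_measurableD]; try exact: bounded_measurableZ.
rewrite !intZ// int_cst// !int_int_sqrD// -/N2 -/PU lerD2r.
by apply: lerD; rewrite ler_wpM2l ?divr_ge0 ?invr_ge0 ?(ltW phi0)//; lra.
Qed.

(** Positive and negative parts decouple: the cross terms <a, P b> and <b, P a>
    are nonnegative and enter the form of a - b with a minus sign. *)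
Lemma dirichlet_disjoint a b : bounded_measurable a -> bounded_measurable b ->
  (forall x, 0 <= a x) -> (forall x, 0 <= b x) -> (forall x, a x * b x = 0) ->
  \int[pi]_x ((a x - b x) ^+ 2) = \int[pi]_x (a x ^+ 2) + \int[pi]_x (b x ^+ 2) /\
  \int[pi]_x ((a x - b x) * P (fun y => a y - b y) x)
    <= \int[pi]_x (a x * P a x) + \int[pi]_x (b x * P b x).
Proof.
move=> ba bb a0 b0 ab0; split.
  rewrite -intD//; try exact: bounded_measurable_sqr.
  by apply: eq_Rintegral => x _; rewrite sqrrB ab0 mul0rn subr0.
have bPa := markov_op_bm K ba; have bPb := markov_op_bm K bb.
rewrite -intD//; try exact: bounded_measurableM.
rewrite markov_opB//; apply: int_le => //.
- by apply: bounded_measurableM; exact: bounded_measurableB.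
- by apply: bounded_measurableD; exact: bounded_measurableM.
move=> x; have Pa0 : 0 <= P a x by exact: Rintegral_ge0.
have Pb0 : 0 <= P b x by exact: Rintegral_ge0.
have := mulr_ge0 (a0 x) Pb0; have := mulr_ge0 (b0 x) Pa0; lra.
Qed.

Lemma dirichlet_shift (t : R) g : bounded_measurable g -> \int[pi]_x g x = 0 ->
  \int[pi]_x ((g x - t) ^+ 2) = \int[pi]_x (g x ^+ 2) + t ^+ 2 /\
  \int[pi]_x ((g x - t) * P (fun y => g y - t) x)
    = \int[pi]_x (g x * P g x) + t ^+ 2.
Proof.
move=> bg g0; have bPg := markov_op_bm K bg.
have bt := bounded_measurable_cst T t.
have bt2 := bounded_measurable_cst T (t ^+ 2).
have expand a b : bounded_measurable a -> bounded_measurable b ->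
    \int[pi]_x a x = 0 -> \int[pi]_x b x = 0 ->
    \int[pi]_x ((a x - t) * (b x - t)) = \int[pi]_x (a x * b x) + t ^+ 2.
  move=> ba bb a0 b0; have bab := bounded_measurableM ba bb.
  have bD := bounded_measurableD ba bb.
  transitivity (\int[pi]_x ((a x * b x + t ^+ 2) - t * (a x + b x))).
    by apply: eq_Rintegral => x _; ring.
  rewrite intB//; [|exact: bounded_measurableD|exact: bounded_measurableZ].
  by rewrite intD// int_cst// intZ// intD// a0 b0 addr0 mulr0 subr0.
split; first exact: expand.
rewrite markov_opB// markov_op_cst; apply: expand => //.
by rewrite (markov_op_stationary Krev).
Qed.

(** Subtracting a median t leaves a positive and a negative part which are each
    supported on a set of measure at most 1/2.  The shift does not change the
    Dirichlet form and only increases the second moment. *)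
Lemma cheeger_inequality (phi : R) g : 0 < phi -> isoperimetric phi ->
  bounded_measurable g -> \int[pi]_x g x = 0 ->
  \int[pi]_x (g x * P g x) <= (1 - phi ^+ 2 / 2) * \int[pi]_x (g x ^+ 2).
Proof.
move=> phi0 iso bg g0.
have [t [t_sup t_inf]] := median_exists pi bg.
pose hp x := Num.max (g x - t) 0; pose hm x := Num.max (t - g x) 0.
have bt := bounded_measurable_cst T t.
have bhp : bounded_measurable hp.
  by apply: bounded_measurable_max0; exact: bounded_measurableB.
have bhm : bounded_measurable hm.
  by apply: bounded_measurable_max0; exact: bounded_measurableB.
have hp0 x : 0 <= hp x by rewrite le_max lexx orbT.
have hm0 x : 0 <= hm x by rewrite le_max lexx orbT.
have hpmE x : hp x - hm x = g x - t.
  rewrite /hp /hm; have [gt|/ltW tg] := leP (g x) t.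
    by rewrite max_r ?subr_le0// max_l ?subr_ge0// sub0r opprB.
  by rewrite max_l ?subr_ge0// max_r ?subr_le0// subr0.
have hpm x : hp x * hm x = 0.
  rewrite /hp /hm; have [gt|/ltW tg] := leP (g x) t.
    by rewrite max_r ?subr_le0// mul0r.
  by rewrite mulrC max_r ?subr_le0// mul0r.
have Hp : phi ^+ 2 / 2 * \int[pi]_x (hp x ^+ 2) <=
    \int[pi]_x (hp x ^+ 2) - \int[pi]_x (hp x * P hp x).
  apply: cheeger_half_support => //.
  rewrite (_ : [set x | _] = [set x | t < g x])//.
  by apply/seteqP; split => x /=; rewrite /hp lt_max ltxx orbF subr_gt0.
have Hm : phi ^+ 2 / 2 * \int[pi]_x (hm x ^+ 2) <=
    \int[pi]_x (hm x ^+ 2) - \int[pi]_x (hm x * P hm x).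
  apply: cheeger_half_support => //.
  rewrite (_ : [set x | _] = [set x | g x < t])//.
  by apply/seteqP; split => x /=; rewrite /hm lt_max ltxx orbF subr_gt0.
have [] := dirichlet_disjoint bhp bhm hp0 hm0 hpm.
have -> : (fun y => hp y - hm y) = (fun y => g y - t) by exact/funext.
have -> : \int[pi]_x ((hp x - hm x) ^+ 2) = \int[pi]_x ((g x - t) ^+ 2).
  by apply: eq_Rintegral => x _; rewrite hpmE.
have -> : \int[pi]_x ((hp x - hm x) * P (fun y => g y - t) x) =
    \int[pi]_x ((g x - t) * P (fun y => g y - t) x).
  by apply: eq_Rintegral => x _; rewrite hpmE.
have [-> ->] := dirichlet_shift t bg g0.
move: Hp Hm.
move: (\int[pi]_x (hp x ^+ 2)) (\int[pi]_x (hp x * P hp x)) => np qp.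
move: (\int[pi]_x (hm x ^+ 2)) (\int[pi]_x (hm x * P hm x)) => nm qm.
have := int_sqr_ge0 pi g.
move: (\int[pi]_x (g x ^+ 2)) (\int[pi]_x (g x * P g x)) => n q n0 Hp Hm sqE formE.
have ct : 0 <= phi ^+ 2 / 2 * t ^+ 2 by rewrite mulr_ge0 ?sqr_ge0 ?divr_ge0 ?sqr_ge0.
have := congr1 (fun z => phi ^+ 2 / 2 * z) sqE.
by rewrite /= !mulrDr; lra.
Qed.

(** The form <u, P v> is nonnegative; its value at u = P g - t g compares
    |P g|^2 = <g, P (P g)> with the values of the form at g and at P g. *)
Lemma mean_zero_contraction (lam : R) g : lazy_kernel K -> 0 <= lam ->
  (forall g, bounded_measurable g -> \int[pi]_x g x = 0 ->
    \int[pi]_x (g x * P g x) <= lam * \int[pi]_x (g x ^+ 2)) ->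
  bounded_measurable g -> \int[pi]_x g x = 0 ->
  \int[pi]_x (P g x ^+ 2) <= lam ^+ 2 * \int[pi]_x (g x ^+ 2).
Proof.
move=> Klazy lam0 gap bg g0.
have bPg := markov_op_bm K bg; have bPPg := markov_op_bm K bPg.
have Pg0 : \int[pi]_x P g x = 0 by rewrite (markov_op_stationary Krev).
have gap_g := gap _ bg g0; have gap_Pg := gap _ bPg Pg0.
(* Positivity of the form at P g - t g, for a t to be chosen. *)
have form t : 0 <= \int[pi]_x (P g x * P (P g) x)
    - 2 * t * \int[pi]_x (P g x ^+ 2) + t ^+ 2 * \int[pi]_x (g x * P g x).
  have btg := bounded_measurableZ t bg.
  have := markov_op_form_ge0 Krev Klazy (bounded_measurableB bPg btg).
  rewrite markov_opB//.
  have -> : P (fun x => t * g x) = fun x => t * P g x.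
    by have [_ -> //] := linear_contraction_markov_op K.
  move=> H; apply: le_trans H _.
  have -> : 2 * t * \int[pi]_x (P g x ^+ 2) =
      t * (\int[pi]_x (P g x * P g x) + \int[pi]_x (g x * P (P g) x)).
    by rewrite (markov_op_sym Krev bg bPg); ring.
  rewrite -intD//; try exact: bounded_measurableM.
  rewrite -!intZ//; do ?[apply: bounded_measurableD|exact: bounded_measurableM].
  rewrite -intB//; 
    do ?[apply: bounded_measurableZ|apply: bounded_measurableD
        |exact: bounded_measurableM].
  rewrite -intD//; 
    do ?[apply: bounded_measurableB|apply: bounded_measurableZ
        |apply: bounded_measurableD|exact: bounded_measurableM].
  rewrite le_eqVlt; apply/orP; left; apply/eqP.
  by apply: eq_Rintegral => x _; ring.
have := int_sqr_ge0 pi (P g); have := int_sqr_ge0 pi g.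
move: form gap_g gap_Pg.
move: (\int[pi]_x (P g x * P (P g) x)) (\int[pi]_x (g x * P g x)).
move: (\int[pi]_x (P g x ^+ 2)) (\int[pi]_x (g x ^+ 2)) => v n q2 q1 form q1n q2v n0 v0.
(* For lam > 0 the value t = lam gives the claim, for lam = 0 any t > 0 does. *)
have [l0|ln0] := eqVneq lam 0.
  by have := form 1; rewrite l0; move: q1n q2v; rewrite l0; lra.
have lp : 0 < lam by rewrite lt0r ln0.
have := form lam => f; suff: lam * v <= lam * (lam ^+ 2 * n) by rewrite ler_pM2l.
have : lam ^+ 2 * q1 <= lam ^+ 2 * (lam * n) by rewrite ler_wpM2l// sqr_ge0.
lra.
Qed.

End cheeger.

(** * Norms, domination and covariances along the chain *)

Section L2_norm.
Context (R : realType) (d : measure_display) (T : measurableType d).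
Context (m : {measure set T -> \bar R}) (m1 : m setT = 1%E).
Implicit Types (h u : T -> R).

Definition L2norm h : R := Num.sqrt (\int[m]_x (h x ^+ 2)).

Lemma L2norm_ge0 h : 0 <= L2norm h. Proof. exact: sqrtr_ge0. Qed.

Lemma L2norm_sqr h : L2norm h ^+ 2 = \int[m]_x (h x ^+ 2).
Proof. by rewrite sqr_sqrtr// int_sqr_ge0. Qed.

Lemma L2norm_CauchySchwarz h1 h2 :
  bounded_measurable h1 -> bounded_measurable h2 ->
  `|\int[m]_x (h1 x * h2 x)| <= L2norm h1 * L2norm h2.
Proof.
move=> b1 b2; rewrite -ler_sqr ?nnegrE ?mulr_ge0 ?L2norm_ge0//.
by rewrite real_normK ?num_real// exprMn !L2norm_sqr int_CauchySchwarz.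
Qed.

Lemma norm_bound_ge0 h C : (forall x, `|h x| <= C) -> 0 <= C.
Proof.
move=> hC; rewrite -(int_cst m1 0) -[leRHS](int_cst m1).
apply: int_le => //; try exact: bounded_measurable_cst.
by move=> x; exact: le_trans (hC x).
Qed.

Lemma L2normM_le C h1 h2 : bounded_measurable h1 -> bounded_measurable h2 ->
  (forall x, `|h1 x| <= C) -> L2norm (fun x => h1 x * h2 x) <= C * L2norm h2.
Proof.
move=> b1 b2 hC; have C0 := norm_bound_ge0 hC.
rewrite -ler_sqr ?nnegrE ?mulr_ge0 ?L2norm_ge0// exprMn !L2norm_sqr.
rewrite -intZ//; last exact: bounded_measurable_sqr.
apply: int_le => //.
- exact/bounded_measurable_sqr/bounded_measurableM.
- exact/bounded_measurableZ/bounded_measurable_sqr.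
move=> x; rewrite exprMn ler_wpM2r ?sqr_ge0//.
by rewrite -real_normK ?num_real// ler_sqr ?nnegrE.
Qed.

Lemma L2norm_center_le h : bounded_measurable h ->
  L2norm (fun x => h x - \int[m]_y h y) <= L2norm h.
Proof.
move=> bh; rewrite -ler_sqr ?nnegrE ?L2norm_ge0// !L2norm_sqr.
have bc := bounded_measurable_cst T (\int[m]_y h y).
have := int_sqrD m1 (-1) bh bc; rewrite int_cst//.
under [X in _ = _ + _ * X + _ -> _]eq_Rintegral do rewrite mulrC.
rewrite intZ//; under eq_Rintegral do rewrite mulN1r.
move=> ->; have := sqr_ge0 (\int[m]_y h y); lra.
Qed.

End L2_norm.

(** The Cheeger inequality would make the form negative for larger phi.  Hence a
    non-constant function forces the conductance to be finite. *)
Lemma isoperimetric_constant_le (R : realType) d (T : measurableType d)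
    (K : R.-pker T ~> T) (pi : probability T R) (phi : R) (g : T -> R) :
  reversible K pi -> lazy_kernel K -> 0 < phi -> isoperimetric K pi phi ->
  bounded_measurable g -> \int[pi]_x g x = 0 -> L2norm pi g != 0 ->
  phi ^+ 2 / 2 <= 1.
Proof.
move=> Krev Klazy p0 iso bg g0 s_neq0; have := cheeger_inequality Krev p0 iso bg g0.
move=> /(le_trans (markov_op_form_ge0 Krev Klazy bg)).
by rewrite -L2norm_sqr pmulr_lge0 ?subr_ge0// exprn_gt0// lt0r s_neq0 L2norm_ge0.
Qed.

(** Domination on sets passes to the superlevel sets of u, hence to its layer-cake
    sums. *)
Lemma int_le_dominated (R : realType) d (T : measurableType d)
    (nu pi : probability T R) (M : R) (u : T -> R) : 0 <= M ->
  (forall A, measurable A -> fine (nu A) <= M * fine (pi A)) ->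
  bounded_measurable u -> (forall x, 0 <= u x) ->
  \int[nu]_x u x <= M * \int[pi]_x u x.
Proof.
move=> M0 nuM bu u0; have [mu [C uC]] := bu.
have nu1 : nu setT = 1%E by exact: probability_setT.
have pi1 : pi setT = 1%E by exact: probability_setT.
apply/ler_addgt0Pr => e' e'0.
have [e e0 Me] : exists2 e, 0 < e & M * e <= e'.
  have M1 : 0 < M + 1 by lra.
  exists (e' / (M + 1)); first exact: divr_gt0.
  by rewrite mulrA ler_pdivrMr// mulrC ler_wpM2l ?ltW//; lra.
have [N NC] := layer_count C e0.
have bA k : bounded_measurable (\1_[set y | k%:R * e < u y] : T -> R).
  exact/bounded_measurable_indic/measurable_superlevel.
have blay : bounded_measurable (fun x => layers e N (u x)).
  under eq_fun do rewrite layersE.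
  by apply: bounded_measurable_sum => k; exact: bounded_measurableZ.
have int_lay (mu0 : probability T R) : \int[mu0]_x layers e N (u x) =
    \sum_(k < N) e * fine (mu0 [set y | k%:R * e < u y]).
  have mu1 : mu0 setT = 1%E by exact: probability_setT.
  under eq_Rintegral do rewrite layersE.
  rewrite int_sum//; last by move=> k; exact: bounded_measurableZ.
  apply: eq_bigr => k _; rewrite intZ// int_indic//.
  exact: measurable_superlevel.
apply: (@le_trans _ _ (\int[nu]_x layers e N (u x))).
  apply: int_le => // x; apply: layers_ge; first exact: ltW.
  by apply: le_trans NC; apply: le_trans (uC x); exact: ler_norm.
apply: (@le_trans _ _ (M * \int[pi]_x layers e N (u x))).
  rewrite !int_lay mulr_sumr; apply: ler_sum => k _.
  rewrite mulrCA ler_wpM2l//; first exact: ltW.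
  by apply: nuM; exact: measurable_superlevel.
have : \int[pi]_x layers e N (u x) <= \int[pi]_x u x + e.
  rewrite -[X in _ + X](int_cst pi1) -intD//; last exact: bounded_measurable_cst.
  apply: int_le => //.
    by apply: bounded_measurableD => //; exact: bounded_measurable_cst.
  by move=> x; apply: layers_le => //; exact: ltW.
move=> /(ler_wpM2l M0)/le_trans; apply.
by rewrite mulrDr lerD2l.
Qed.

Lemma int_le_L2norm_dominated (R : realType) d (T : measurableType d)
    (nu pi : probability T R) (M : R) (u : T -> R) : 0 <= M ->
  (forall A, measurable A -> fine (nu A) <= M * fine (pi A)) ->
  bounded_measurable u -> `|\int[nu]_x u x| <= Num.sqrt M * L2norm pi u.
Proof.
move=> M0 nuM bu.
rewrite -ler_sqr ?nnegrE ?mulr_ge0 ?L2norm_ge0 ?sqrtr_ge0//.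
rewrite real_normK ?num_real// exprMn sqr_sqrtr// L2norm_sqr.
apply: le_trans (int_sqr_le (probability_setT nu) bu) _.
apply: int_le_dominated => //; [exact: bounded_measurable_sqr|].
by move=> x; exact: sqr_ge0.
Qed.

Lemma iter_linear_contraction (R : realType) d (T : measurableType d)
    (F : (T -> R) -> (T -> R)) k :
  linear_contraction F -> linear_contraction (iter k F).
Proof.
move=> HF; elim: k => [|k IH]; first exact: linear_contraction_id.
exact: (linear_contraction_comp IH HF).
Qed.

Section chain.
Context (R : realType) (d d' : measure_display).
Context (T : measurableType d) (W : measurableType d') (Pr : probability W R).
Context (X : nat -> {RV Pr >-> T}) (nu : probability T R) (K : R.-pker T ~> T).
Context (Xmc : markov_chain X nu K).
Implicit Types (a b h : T -> R).
Local Notation P := (markov_op K).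

Let Pr1 : Pr setT = 1%E. Proof. exact: probability_setT. Qed.

Lemma history_preimage i j (A : set T) : (i <= j)%N -> measurable A ->
  history X j (X i @^-1` A).
Proof.
move=> ij mA; apply: sub_sigma_algebra; exists i => /=; first by rewrite ltnS.
by exists A => //; rewrite setTI.
Qed.

(** The Markov property, tested against functions of a single past state. *)
Lemma chain_next a b i j : (i <= j)%N ->
  bounded_measurable a -> bounded_measurable b ->
  \int[Pr]_w (a (X i w) * b (X j.+1 w)) = \int[Pr]_w (a (X i w) * P b (X j w)).
Proof.
move=> ij ba bb.
have mX k : measurable_fun setT (X k) by exact: measurable_funP.
have comp k h : bounded_measurable h -> bounded_measurable (h \o X k).
  by move=> bh; exact: bounded_measurable_comp.
have ctr k := linear_contraction_comp_fun R (mX k).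
have comm (f g : W -> R) : \int[Pr]_w (f w * g w) = \int[Pr]_w (g w * f w).
  by apply: eq_Rintegral => w _; rewrite mulrC.
have ctrP := linear_contraction_comp (linear_contraction_markov_op K) (ctr j).
move: b bb; apply: (bounded_linear_ext
  (L1 := fun h => \int[Pr]_w (a (X i w) * h (X j.+1 w)))
  (L2 := fun h => \int[Pr]_w (a (X i w) * P h (X j w)))).
- exact: (bounded_linear_int Pr1 (comp i _ ba) (ctr j.+1)).
- exact: (bounded_linear_int Pr1 (comp i _ ba) ctrP).
move=> A mA.
have bA : bounded_measurable (\1_A : T -> R) by exact: bounded_measurable_indic.
move: a ba; apply: (bounded_linear_ext
  (L1 := fun h => \int[Pr]_w (h (X i w) * \1_A (X j.+1 w)))
  (L2 := fun h => \int[Pr]_w (h (X i w) * P \1_A (X j w)))).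
- under eq_fun do rewrite comm.
  exact: (bounded_linear_int Pr1 (comp j.+1 _ bA) (ctr i)).
- under eq_fun do rewrite comm.
  exact: (bounded_linear_int Pr1 (comp j _ (markov_op_bm K bA)) (ctr i)).
move=> C mC.
have := Xmc.2 j A _ mA (history_preimage ij mC).
have mXC : measurable (X i @^-1` C) by rewrite -[_ @^-1` _]setTI; exact: mX.
have mXA : measurable (X j.+1 @^-1` A) by rewrite -[_ @^-1` _]setTI; exact: mX.
move=> mcE.
transitivity (fine (Pr (X i @^-1` C `&` X j.+1 @^-1` A))).
  rewrite -int_indic//; last exact: measurableI.
  by apply: eq_Rintegral => w _; rewrite indicI.
rewrite mcE /Rintegral; congr fine.
rewrite [LHS]integral_mkcond; apply: eq_integral => w _.
have wCE : (X i w \in C) = (w \in X i @^-1` C) by apply/idP/idP; rewrite !inE.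
rewrite patchE indicE wCE; case: ifPn => wC; last by rewrite mul0r.
rewrite mul1r markov_op_indic// fineK//.
exact: kernel_fin.
Qed.

Lemma chain_lag a b i k : bounded_measurable a -> bounded_measurable b ->
  \int[Pr]_w (a (X i w) * b (X (i + k)%N w)) =
  \int[Pr]_w (a (X i w) * iter k P b (X i w)).
Proof.
move=> ba; elim: k b => [|k IH] b bb; first by rewrite addn0.
rewrite addnS chain_next ?leq_addr// IH; last exact: markov_op_bm.
by rewrite iterSr.
Qed.

Lemma chain_initial h : bounded_measurable h ->
  \int[Pr]_w h (X 0%N w) = \int[nu]_x h x.
Proof.
have mX : measurable_fun setT (X 0%N) by exact: measurable_funP.
have ctr := linear_contraction_comp_fun R mX.
have nu1 : nu setT = 1%E by exact: probability_setT.
move=> bh; transitivity (\int[Pr]_w (1 * h (X 0%N w))).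
  by apply: eq_Rintegral => w _; rewrite mul1r.
transitivity (\int[nu]_x (1 * h x)); last first.
  by apply: eq_Rintegral => x _; rewrite mul1r.
move: h bh; apply: (bounded_linear_ext
  (L1 := fun h => \int[Pr]_w (1 * h (X 0%N w)))
  (L2 := fun h => \int[nu]_x (1 * h x))).
- exact: (bounded_linear_int Pr1 (bounded_measurable_cst W 1) ctr).
- exact: (bounded_linear_int nu1 (bounded_measurable_cst T 1)
    (linear_contraction_id R T)).
move=> A mA; have mXA : measurable (X 0%N @^-1` A).
  by rewrite -[_ @^-1` _]setTI; exact: mX.
have bA : bounded_measurable (\1_A : T -> R) by exact: bounded_measurable_indic.
have bAX := bounded_measurable_comp mX bA.
rewrite !intZ//.
congr (1 * _); transitivity (fine (Pr (X 0%N @^-1` A))).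
  exact: (int_indic Pr mXA).
rewrite int_indic//; congr fine; exact: (Xmc.1 A mA).
Qed.

Lemma chain_law h i : bounded_measurable h ->
  \int[Pr]_w h (X i w) = \int[nu]_x iter i P h x.
Proof.
move=> bh; have [bit _ _ _] := iter_linear_contraction i (linear_contraction_markov_op K).
rewrite -chain_initial//; last exact: bit.
have := chain_lag 0 i (bounded_measurable_cst T 1) bh.
rewrite add0n; under eq_Rintegral do rewrite mul1r.
by under [X in _ = X -> _]eq_Rintegral do rewrite mul1r.
Qed.

End chain.

Section covariance.
Context (R : realType) (d d' : measure_display).
Context (T : measurableType d) (W : measurableType d') (Pr : probability W R).
Context (X : nat -> {RV Pr >-> T}) (pi nu : probability T R) (K : R.-pker T ~> T).
Context (Krev : reversible K pi) (Xmc : markov_chain X nu K).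
Context (lam M : R) (lam0 : 0 <= lam) (M0 : 0 <= M).
Local Notation P := (markov_op K).
Context (P_contracts : forall g : T -> R, bounded_measurable g ->
  \int[pi]_x g x = 0 ->
  \int[pi]_x (P g x ^+ 2) <= lam ^+ 2 * \int[pi]_x (g x ^+ 2)).
Context (nuM : forall A, measurable A -> fine (nu A) <= M * fine (pi A)).

Let pi1 : pi setT = 1%E. Proof. exact: probability_setT. Qed.

Lemma iter_markov_op_bm k (h : T -> R) :
  bounded_measurable h -> bounded_measurable (iter k P h).
Proof.
have [bit _ _ _] := iter_linear_contraction k (linear_contraction_markov_op K).
exact: bit.
Qed.

Lemma iter_markov_op_stationary k (h : T -> R) : bounded_measurable h ->
  \int[pi]_x iter k P h x = \int[pi]_x h x.
Proof.
move=> bh; elim: k => [//|k IH].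
by rewrite iterS (markov_op_stationary Krev)//; exact: iter_markov_op_bm.
Qed.

Lemma L2norm_iter_markov_op k (g : T -> R) : bounded_measurable g ->
  \int[pi]_x g x = 0 -> L2norm pi (iter k P g) <= lam ^+ k * L2norm pi g.
Proof.
move=> bg g0; elim: k => [|k IH]; first by rewrite expr0 mul1r.
rewrite exprS -mulrA; apply: le_trans (ler_wpM2l lam0 IH).
rewrite -ler_sqr ?nnegrE ?mulr_ge0 ?L2norm_ge0// exprMn !L2norm_sqr.
apply: P_contracts; first exact: iter_markov_op_bm.
by rewrite iter_markov_op_stationary.
Qed.

(** The first term is the stationary covariance; the second one measures how far
    the law of X_i is from pi. *)
Lemma chain_covariance_le (g : T -> R) C i k : bounded_measurable g ->
  \int[pi]_x g x = 0 -> (forall x, `|g x| <= C) ->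
  `|\int[Pr]_w (g (X i w) * g (X (i + k)%N w))| <=
  L2norm pi g * (L2norm pi g + C * Num.sqrt M * lam ^+ i) * lam ^+ k.
Proof.
move=> bg g0 gC; set s := L2norm pi g.
have s0 : 0 <= s by exact: L2norm_ge0.
have bPk := iter_markov_op_bm k bg.
pose v x := g x * iter k P g x.
have bv : bounded_measurable v by exact: bounded_measurableM.
have PkN : L2norm pi (iter k P g) <= lam ^+ k * s by exact: L2norm_iter_markov_op.
rewrite (chain_lag Xmc)// (chain_law Xmc i bv).
pose c := \int[pi]_x v x.
have bc := bounded_measurable_cst T c.
have bvc : bounded_measurable (fun x => v x - c) by exact: bounded_measurableB.
(* The stationary part: c is an inner product of g with the k-th iterate. *)
have c_le : `|c| <= s * (lam ^+ k * s).
  apply: le_trans (L2norm_CauchySchwarz pi1 bg bPk) _.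
  by rewrite ler_wpM2l.
have PiE : iter i P v = fun x => iter i P (fun x => v x - c) x + c.
  have [_ _ addP _] := iter_linear_contraction i (linear_contraction_markov_op K).
  have icst : iter i P (fun=> c) = fun=> c.
    by elim: (i) => // n IH; rewrite iterS IH markov_op_cst.
  transitivity (fun x => iter i P (fun x => v x - c) x + iter i P (fun=> c) x).
    by rewrite -addP//; congr (iter i P); apply/funext => x; rewrite subrK.
  by rewrite icst.
have bPi := iter_markov_op_bm i bvc.
rewrite PiE intD//; try exact: probability_setT.
rewrite int_cst; last exact: probability_setT.
apply: le_trans (ler_normD _ _) _.
have vcN : L2norm pi (fun x => v x - c) <= C * (lam ^+ k * s).
  apply: le_trans (L2norm_center_le pi1 bv) _.
  apply: le_trans (L2normM_le pi1 bg bPk gC) _.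
  by rewrite ler_wpM2l// (norm_bound_ge0 pi1 gC).
(* The transient part: i further steps, started from nu. *)
have : `|\int[nu]_x iter i P (fun x => v x - c) x| <=
    Num.sqrt M * (lam ^+ i * (C * (lam ^+ k * s))).
  apply: le_trans (int_le_L2norm_dominated M0 nuM bPi) _.
  rewrite ler_wpM2l ?sqrtr_ge0//.
  apply: le_trans (L2norm_iter_markov_op i bvc _) _.
    by rewrite intB// int_cst// subrr.
  by rewrite ler_wpM2l ?exprn_ge0.
move=> /lerD/(_ c_le)/le_trans; apply.
by rewrite le_eqVlt; apply/orP; left; apply/eqP; ring.
Qed.

End covariance.

Lemma geometric_sum_rev_le (R : realFieldType) (lam : R) n : 0 <= lam < 1 ->
  \sum_(i < n.+1) lam ^+ (n - i) <= (1 - lam)^-1.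
Proof.
move=> /andP[lam0 lam1].
have l1 : 0 < 1 - lam by rewrite subr_gt0.
rewrite -[leRHS]mul1r ler_pdivlMr//; elim: n => [|n IH].
  by rewrite big_ord_recr big_ord0/= expr0; lra.
rewrite big_ord_recr/= subnn expr0.
rewrite (eq_bigr (fun i : 'I_n.+1 => lam * lam ^+ (n - i))); last first.
  by move=> i _; rewrite subSn ?exprS// -ltnS.
rewrite -mulr_sumr; move: IH; move: (\sum_(i < n.+1) _) => S IH; nra.
Qed.

(** By induction on n: the new term is correlated with its predecessors and with
    itself by a geometric series, which contributes at most twice D / (1 - lam). *)
Lemma int_sqr_sum_le (R : realType) d (W : measurableType d)
    (Pr : probability W R) (y : nat -> W -> R) (lam D : R) n :
  (forall i, bounded_measurable (y i)) -> 0 <= lam < 1 -> 0 <= D ->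
  (forall i k, `|\int[Pr]_w (y i w * y (i + k)%N w)| <= D * lam ^+ k) ->
  \int[Pr]_w ((\sum_(i < n) y i w) ^+ 2) <= 2 * n%:R * (D / (1 - lam)).
Proof.
move=> by_ lam01 D0 cov.
have Pr1 : Pr setT = 1%E by exact: probability_setT.
elim: n => [|n IH].
  under eq_Rintegral do rewrite big_ord0 expr0n/=.
  by rewrite int_cst// mulr0 mul0r.
have bS : bounded_measurable (fun w => \sum_(i < n) y i w).
  exact: bounded_measurable_sum.
under eq_Rintegral do rewrite big_ord_recr/= -[X in _ + X]mul1r.
rewrite int_sqrD// expr1n mul1r mulr1.
have crossE : \int[Pr]_w ((\sum_(i < n) y i w) * y n w) =
    \sum_(i < n) \int[Pr]_w (y i w * y n w).
  under eq_Rintegral do rewrite mulr_suml.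
  by rewrite int_sum// => i; exact: bounded_measurableM.
have cov_le i : (i <= n)%N -> \int[Pr]_w (y i w * y n w) <= D * lam ^+ (n - i).
  by move=> lein; rewrite -[in y n](subnKC lein) (le_trans (ler_norm _))//.
have : \sum_(i < n.+1) \int[Pr]_w (y i w * y n w) <= D / (1 - lam).
  apply: (@le_trans _ _ (\sum_(i < n.+1) D * lam ^+ (n - i))).
    by apply: ler_sum => i _; apply: cov_le; rewrite -ltnS.
  by rewrite -mulr_sumr ler_wpM2l// geometric_sum_rev_le.
rewrite big_ord_recr/= -crossE.
have -> : \int[Pr]_w (y n w ^+ 2) = \int[Pr]_w (y n w * y n w).
  by apply: eq_Rintegral => w _; rewrite expr2.
have : 0 <= \int[Pr]_w (y n w * y n w) by exact: int_sqr_ge0.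
by rewrite -natr1; lra.
Qed.

(** * Conductance, bounded densities and the mean square error *)

Lemma conductance_isoperimetric (R : realType) d (T : measurableType d)
    (K : R.-pker T ~> T) (pi : probability T R) (phi : R) :
  0 <= phi -> (phi%:E <= conductance K pi)%E -> isoperimetric K pi phi.
Proof.
move=> phi0 phi_le A mA A_half.
have finA : pi A \is a fin_num by exact: fin_num_measure.
have cut0 : 0 <= \int[pi]_x (\1_A x * markov_op K \1_(~` A) x).
  apply: Rintegral_ge0 => x _; apply: mulr_ge0; rewrite ?indicE ?ler0n//.
  by apply: Rintegral_ge0 => y _; rewrite indicE ler0n.
have [A0|A0] := eqVneq (pi A) 0%E; first by rewrite A0 mulr0.
have Agt0 : (0 < pi A)%E by rewrite lt0e A0 measure_ge0.
have mAc : measurable (~` A) by exact: measurableC.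
rewrite -lee_fin EFinM int_indic_markov_op//.
rewrite -lee_pdivlMr ?fineK//; last by rewrite -lte_fin fineK.
apply: le_trans phi_le _.
have -> : ((fine (pi A))^-1%:E = (pi A)^-1 :> \bar R)%E.
  by rewrite -[in RHS](fineK finA) inver fine_eq0// (negPf A0).
by apply: ereal_inf_lbound; exists A.
Qed.

(** The absolute value is needed because a version of the density may be negative
    on a null set. *)
Lemma le_density_Lnorm (R : realType) d (T : measurableType d)
    (nu pi : probability T R) : nu `<< pi ->
  forall A, measurable A ->
  (nu A <= 'N[pi]_+oo[density nu pi] * pi A)%E.
Proof.
move=> nu_pi A mA; set c := ('N[pi]_+oo[density nu pi])%E.
have c0 : (0 <= c)%E by exact: Lnorm_ge0.
have nu_pi' : charge_of_finite_measure nu `<< pi by [].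
have mdens : measurable_fun setT (density nu pi).
  by apply: measurable_int; exact: Radon_Nikodym_integrable.
have dens_le : \forall x \ae pi, (`|density nu pi x| <= c)%E.
  rewrite /c Lnorm.unlock [X in (0 < X)%E]probability_setT lte01; exact: ess_sup_ge.
rewrite (_ : nu A = (\int[pi]_(x in A) density nu pi x)%E); last first.
  by rewrite -Radon_Nikodym_integral.
apply: le_trans (lee_abs _) _.
apply: le_trans (le_abse_integral _ _ _) _ => //.
  exact: measurable_funTS.
rewrite -integral_cst//; apply: ae_ge0_le_integral => //.
  by apply: measurableT_comp => //; exact: measurable_funTS.
by apply: filterS dens_le => x.
Qed.

(** The law of X_i is dominated by M pi: by nu <= M pi and stationarity of pi. *)
Lemma chain_null (R : realType) d d' (T : measurableType d)
    (W : measurableType d') (Pr : probability W R) (X : nat -> {RV Pr >-> T})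
    (pi nu : probability T R) (K : R.-pker T ~> T) (M : R) (A : set T) i :
  reversible K pi -> markov_chain X nu K -> 0 <= M ->
  (forall A, measurable A -> fine (nu A) <= M * fine (pi A)) ->
  measurable A -> pi A = 0%E -> Pr (X i @^-1` A) = 0%E.
Proof.
move=> Krev Xmc M0 nuM mA piA.
have bA : bounded_measurable (\1_A : T -> R) by exact: bounded_measurable_indic.
have mXA : measurable (X i @^-1` A).
  by rewrite -[_ @^-1` _]setTI; exact: measurable_funP.
have bit := iter_markov_op_bm K i bA.
have it0 k x : 0 <= iter k (markov_op K) \1_A x.
  elim: k x => [|k IH] x; first by rewrite /= indicE ler0n.
  by apply: Rintegral_ge0 => y _; exact: IH.
have PrE : fine (Pr (X i @^-1` A)) = \int[nu]_x iter i (markov_op K) \1_A x.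
  by rewrite -(chain_law Xmc i bA) -[LHS](int_indic Pr mXA).
have : fine (Pr (X i @^-1` A)) <= 0.
  rewrite PrE; apply: le_trans (int_le_dominated M0 nuM bit (it0 i)) _.
  rewrite (iter_markov_op_stationary Krev)// int_indic//.
  by rewrite [X in fine X]piA mulr0.
rewrite -lee_fin fineK ?fin_num_measure// => le0.
by apply/eqP; rewrite eq_le le0 measure_ge0.
Qed.

(** The burn-in n0 offsets the initial density, as 1 - t <= exp (- t). *)
Lemma power_gap_le (R : realType) (phi M : R) (n0 : nat) :
  0 < phi -> phi ^+ 2 / 2 <= 1 -> 1 <= M -> ln M / phi ^+ 2 <= n0%:R ->
  Num.sqrt M * (1 - phi ^+ 2 / 2) ^+ n0 <= 1.
Proof.
move=> phi0 phi1 M1 hn0; have M0 : 0 < M by lra.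
have p2 : 0 < phi ^+ 2 by rewrite exprn_gt0.
have l0 : 0 <= 1 - phi ^+ 2 / 2 by rewrite subr_ge0.
rewrite -ler_sqr ?nnegrE ?mulr_ge0 ?sqrtr_ge0 ?exprn_ge0//.
rewrite expr1n exprMn sqr_sqrtr ?(ltW M0)// -exprM mulnC exprM.
(* After squaring, the claim is M times the 2 n0-th power being at most 1. *)
have step : (1 - phi ^+ 2 / 2) ^+ 2 <= expR (- phi ^+ 2).
  have -> : - phi ^+ 2 = 2%:R * (- (phi ^+ 2 / 2)) by field.
  rewrite expRM_natl ler_sqr ?nnegrE ?expR_ge0//.
  exact: expR_ge1Dx.
apply: (@le_trans _ _ (M * expR (- phi ^+ 2) ^+ n0)).
  by rewrite ler_wpM2l ?(ltW M0)// lerXn2r ?nnegrE ?sqr_ge0 ?expR_ge0.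
rewrite -expRM_natl -{1}[M]lnK ?posrE// -expRD -[leRHS]expR0 ler_expR.
by move: hn0; rewrite ler_pdivrMr//; lra.
Qed.

Section mean_square_error.
Context (R : realType) (d d' : measure_display).
Context (T : measurableType d) (W : measurableType d') (Pr : probability W R).
Context (X : nat -> {RV Pr >-> T}) (pi nu : probability T R) (K : R.-pker T ~> T).
Context (Krev : reversible K pi) (Klazy : lazy_kernel K) (Xmc : markov_chain X nu K).
Context (M : R) (M0 : 0 <= M).
Context (nuM : forall A, measurable A -> fine (nu A) <= M * fine (pi A)).

(** The index i.+1 appears because averaging starts at X_1. *)
Lemma mean_square_error_le (phi : R) (g : T -> R) C n n0 :
  0 < phi -> phi ^+ 2 / 2 <= 1 -> isoperimetric K pi phi ->
  bounded_measurable g -> \int[pi]_x g x = 0 -> (forall x, `|g x| <= C) ->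
  (0 < n)%N ->
  \int[Pr]_w ((n%:R^-1 * \sum_(i < n) g (X (i.+1 + n0)%N w)) ^+ 2) <=
  4 * (L2norm pi g * (L2norm pi g +
       C * (Num.sqrt M * (1 - phi ^+ 2 / 2) ^+ n0))) / (n%:R * phi ^+ 2).
Proof.
move=> phi0 phi1 iso bg g0 gC n_gt0.
set s := L2norm pi g; set lam := 1 - phi ^+ 2 / 2.
have s0 : 0 <= s by exact: L2norm_ge0.
have p2 : 0 < phi ^+ 2 by rewrite exprn_gt0.
have lam0 : 0 <= lam by rewrite subr_ge0.
have lam1 : lam < 1 by rewrite /lam ltrBlDr ltrDl divr_gt0.
have pi1 : pi setT = 1%E by exact: probability_setT.
have Pr1 : Pr setT = 1%E by exact: probability_setT.
have C0 := norm_bound_ge0 pi1 gC.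
set D := s * (s + C * (Num.sqrt M * lam ^+ n0)).
have D0 : 0 <= D.
  by rewrite !(mulr_ge0, addr_ge0)// ?sqrtr_ge0 ?exprn_ge0.
have contr (h : T -> R) : bounded_measurable h -> \int[pi]_x h x = 0 ->
    \int[pi]_x (markov_op K h x ^+ 2) <= lam ^+ 2 * \int[pi]_x (h x ^+ 2).
  apply: mean_zero_contraction => // h'; exact: cheeger_inequality.
pose y i := g \o X (i.+1 + n0)%N.
have by_ i : bounded_measurable (y i).
  by apply: bounded_measurable_comp => //; exact: measurable_funP.
have cov i k : `|\int[Pr]_w (y i w * y (i + k)%N w)| <= D * lam ^+ k.
  rewrite /y; have -> : ((i + k).+1 + n0 = i.+1 + n0 + k)%N by rewrite -addSn addnAC.
  apply: le_trans (chain_covariance_le Krev Xmc lam0 M0 contr nuM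
    (i.+1 + n0) k bg g0 gC) _.
  rewrite ler_wpM2r ?exprn_ge0// /D -/s ler_wpM2l// lerD2l -mulrA ler_wpM2l//.
  rewrite ler_wpM2l ?sqrtr_ge0// addnC exprD -[leRHS]mulr1 ler_wpM2l ?exprn_ge0//.
  by rewrite exprn_ile1// ltW.
have lam01 : 0 <= lam < 1 by rewrite lam0.
have := int_sqr_sum_le n by_ lam01 D0 cov.
have bS : bounded_measurable (fun w => \sum_(i < n) y i w).
  exact: bounded_measurable_sum.
have nn0 : n%:R != 0 :> R by rewrite pnatr_eq0 -lt0n.
have -> : \int[Pr]_w ((n%:R^-1 * \sum_(i < n) g (X (i.+1 + n0)%N w)) ^+ 2) =
    n%:R^-1 ^+ 2 * \int[Pr]_w ((\sum_(i < n) y i w) ^+ 2).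
  rewrite -intZ//; last exact: bounded_measurable_sqr.
  by apply: eq_Rintegral => w _; rewrite exprMn.
move=> H; apply: le_trans (ler_wpM2l (sqr_ge0 _) H) _.
rewrite le_eqVlt; apply/orP; left; apply/eqP; rewrite /lam.
by field; rewrite nn0/=; apply/andP; split; [exact: lt0r_neq0|rewrite gt_eqF//; lra].
Qed.

End mean_square_error.

(** * Essentially bounded functions and the error bound *)

Lemma ae_le_Lnorm_oo (R : realType) d (T : measurableType d)
    (pi : probability T R) (f : T -> R) (B : R) : measurable_fun setT f ->
  ('N[pi]_+oo[EFin \o f] = B%:E)%E -> pi [set x | B < `|f x|] = 0%E.
Proof.
move=> mf NB; have mA : measurable [set x | B < `|f x|].
  by apply: measurable_superlevel; exact: measurableT_comp.
have : \forall x \ae pi, `|f x| <= B.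
  have : \forall x \ae pi, (`|(f x)%:E| <= 'N[pi]_+oo[EFin \o f])%E.
    rewrite Lnorm.unlock [X in (0 < X)%E]probability_setT lte01.
    exact: ess_sup_ge.
  by apply: filterS => x; rewrite NB lee_fin.
move=> [N [mN N0 sub]]; apply/eqP; rewrite eq_le measure_ge0 andbT -N0.
apply: le_measure; rewrite ?inE// => x /= Bx; apply: sub => /=.
by apply/negP; rewrite -ltNge.
Qed.

Section truncation.
Context (R : realType) (d d' : measure_display).
Context (T : measurableType d) (W : measurableType d') (Pr : probability W R).
Context (X : nat -> {RV Pr >-> T}) (pi : probability T R) (f : T -> R) (B : R).
Context (mf : measurable_fun setT f) (B0 : 0 <= B).
Context (pi_null : pi [set x | B < `|f x|] = 0%E).
Context (X_null : forall i, Pr (X i @^-1` [set x | B < `|f x|]) = 0%E).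

Definition truncate x : R := Num.max (- B) (Num.min B (f x)).
Definition centered_truncation x : R := truncate x - \int[pi]_y truncate y.

Lemma truncate_le x : `|truncate x| <= B.
Proof.
rewrite /truncate ler_norml le_max lexx/= ge_max ge_min lexx/= andbT.
by rewrite (le_trans _ B0)// oppr_le0.
Qed.

Lemma truncate_id x : `|f x| <= B -> truncate x = f x.
Proof. by rewrite ler_norml /truncate => /andP[? ?]; rewrite min_r// max_r. Qed.

Lemma bounded_measurable_truncate : bounded_measurable truncate.
Proof.
split; last by exists B; exact: truncate_le.
by apply: measurable_maxr => //; exact: measurable_minr.
Qed.

Lemma Rintegral_truncate : Rintegral pi setT f = \int[pi]_y truncate y.
Proof.
congr fine; apply: ae_eq_integral => //.
- exact/measurable_EFinP.
- by apply/measurable_EFinP; have [] := bounded_measurable_truncate.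
exists [set x | B < `|f x|]; split => //.
  by apply: measurable_superlevel; exact: measurableT_comp.
move=> x /= H; rewrite ltNge; apply/negP => fx; apply: H => _.
by rewrite truncate_id.
Qed.

Lemma bounded_measurable_centered_truncation :
  bounded_measurable centered_truncation.
Proof.
apply: bounded_measurableB; first exact: bounded_measurable_truncate.
exact: bounded_measurable_cst.
Qed.

Let pi1 : pi setT = 1%E. Proof. exact: probability_setT. Qed.

Lemma int_centered_truncation : \int[pi]_x centered_truncation x = 0.
Proof.
have bt := bounded_measurable_truncate.
by rewrite intB// ?int_cst ?subrr//; exact: bounded_measurable_cst.
Qed.

Lemma centered_truncation_le x : `|centered_truncation x| <= 2 * B.
Proof.
apply: le_trans (ler_normB _ _) _.
have := truncate_le x.
have := int_norm_le pi1 bounded_measurable_truncate truncate_le; lra.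
Qed.

Lemma L2norm_centered_truncation : L2norm pi centered_truncation <= B.
Proof.
have bt := bounded_measurable_truncate.
apply: le_trans (L2norm_center_le pi1 bt) _.
have := L2normM_le pi1 bt (bounded_measurable_cst T 1) truncate_le.
rewrite /L2norm; under eq_Rintegral do rewrite mulr1.
by rewrite expr1n int_cst// sqrtr1 mulr1.
Qed.

Lemma rmse_truncate n n0 : (0 < n)%N -> rmse pi X f n n0 =
  (Num.sqrt (\int[Pr]_w
    ((n%:R^-1 * \sum_(i < n) centered_truncation (X (i.+1 + n0)%N w)) ^+ 2)))%:E.
Proof.
move=> n_gt0; have nn0 : n%:R != 0 :> R by rewrite pnatr_eq0 -lt0n.
have mX i : measurable_fun setT (X i) by exact: measurable_funP.
have bc := bounded_measurable_centered_truncation.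
have bh : bounded_measurable (fun w =>
    (n%:R^-1 * \sum_(i < n) centered_truncation (X (i.+1 + n0)%N w)) ^+ 2).
  apply/bounded_measurable_sqr/bounded_measurableZ.
  by apply: bounded_measurable_sum => i; exact: (bounded_measurable_comp (mX _) bc).
have sampleE w : sample_mean X f n n0 w =
    n%:R^-1 * \sum_(i < n) f (X (i.+1 + n0)%N w).
  by rewrite /sample_mean big_add1/= big_mkord.
have msample : measurable_fun setT (sample_mean X f n n0).
  rewrite (funext sampleE); apply: measurable_funM => //.
  by apply: measurable_sum => i; exact: measurableT_comp.
have agree : \forall w \ae Pr, forall i, f (X i w) = truncate (X i w).
  apply: ae_foralln => i; exists (X i @^-1` [set x | B < `|f x|]).
  split; [|exact: X_null|].
    rewrite -[_ @^-1` _]setTI; apply: mX => //.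
    by apply: measurable_superlevel; exact: measurableT_comp.
  move=> w /= H; rewrite ltNge; apply/negP => fx; apply: H.
  by rewrite truncate_id.
rewrite /rmse expectation.unlock.
have -> : (\int[Pr]_w (`|sample_mean X f n n0 w - Rintegral pi setT f| ^+ 2)%:E =
    \int[Pr]_w ((n%:R^-1 *
      \sum_(i < n) centered_truncation (X (i.+1 + n0)%N w)) ^+ 2)%:E)%E.
  apply: ae_eq_integral => //.
  - apply/measurable_EFinP; apply: measurable_funX; apply: measurableT_comp => //.
    exact: measurable_funB.
  - by apply/measurable_EFinP; case: bh.
  apply: filterS agree => w fw _; congr EFin.
  rewrite real_normK ?num_real// sampleE Rintegral_truncate; congr (_ ^+ 2).
  rewrite /centered_truncation sumrB sumr_const card_ord.
  under eq_bigr do rewrite fw.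
  by rewrite -[(\int[pi]_y _) *+ n]mulr_natl mulrBr mulKf.
rewrite -[X in sqrte X]fineK//.
by apply: integrable_fin_num => //; apply: integrable_bm => //; exact: probability_setT.
Qed.

End truncation.

Section error_bound.
Context (R : realType) (d d' : measure_display).
Context (T : measurableType d) (W : measurableType d') (Pr : probability W R).
Context (X : nat -> {RV Pr >-> T}) (pi nu : probability T R).
Context (K : R.-pker T ~> T) (Krev : reversible K pi).
Context (Klazy : lazy_kernel K) (Xmc : markov_chain X nu K).
Context (M : R) (M0 : 0 <= M).
Context (nuM : forall A, measurable A -> fine (nu A) <= M * fine (pi A)).
Context (f : T -> R) (B : R) (mf : measurable_fun setT f) (B0 : 0 <= B).
Context (pi_null : pi [set x | B < `|f x|] = 0%E).
Local Notation g := (centered_truncation pi f B).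

Lemma rmse_le_isoperimetric (phi : R) n n0 :
  0 < phi -> phi ^+ 2 / 2 <= 1 -> isoperimetric K pi phi -> (0 < n)%N ->
  (rmse pi X f n n0 <= (Num.sqrt (4 * (L2norm pi g * (L2norm pi g +
     2 * B * (Num.sqrt M * (1 - phi ^+ 2 / 2) ^+ n0))) /
     (n%:R * phi ^+ 2)))%:E)%E.
Proof.
move=> phi0 phi1 iso n_gt0.
have mA : measurable [set x | B < `|f x|].
  by apply: measurable_superlevel; exact: measurableT_comp.
have X_null i := chain_null i Krev Xmc M0 nuM mA pi_null.
rewrite (rmse_truncate mf B0 pi_null X_null n0 n_gt0) lee_fin.
apply: ler_wsqrtr.
exact: (mean_square_error_le Krev Klazy Xmc M0 nuM n0 phi0 phi1 iso
  (bounded_measurable_centered_truncation pi mf B0)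
  (int_centered_truncation pi mf B0)
  (centered_truncation_le pi mf B0) n_gt0).
Qed.

End error_bound.

(** The left-hand side is at most sqrt 12 B / (phi sqrt n). *)
Lemma error_constant_le (R : realType) (phi s B c : R) n : 0 < phi -> (0 < n)%N ->
  0 <= s <= B -> 0 <= c <= 1 ->
  Num.sqrt (4 * (s * (s + 2 * B * c)) / (n%:R * phi ^+ 2)) <=
  10 / (phi * Num.sqrt n%:R) * B.
Proof.
move=> phi0 n_gt0 /andP[s0 sB] /andP[c0 c1].
have B0 : 0 <= B by exact: le_trans sB.
have nn0 : 0 < n%:R :> R by rewrite ltr0n.
have sn0 : 0 < Num.sqrt n%:R :> R by rewrite sqrtr_gt0.
have rhs0 : 0 <= 10 / (phi * Num.sqrt n%:R) * B.
  by rewrite mulr_ge0// divr_ge0// mulr_ge0// ltW.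
have B2 : 0 <= 2 * B by rewrite mulr_ge0.
rewrite -ler_sqr ?nnegrE ?sqrtr_ge0// sqr_sqrtr; last first.
  apply: divr_ge0; last by rewrite mulr_ge0 ?sqr_ge0// ltW.
  by apply: mulr_ge0 => //; rewrite mulr_ge0// addr_ge0// mulr_ge0.
have -> : (10 / (phi * Num.sqrt n%:R) * B) ^+ 2 = 100 * B ^+ 2 / (n%:R * phi ^+ 2).
  rewrite -[in RHS](@sqr_sqrtr _ n%:R) ?ltW//.
  by field; rewrite !gt_eqF.
rewrite ler_pM2r ?invr_gt0 ?mulr_gt0 ?exprn_gt0//.
have : s * (s + 2 * B * c) <= B * (B + 2 * B * 1).
  have Bc : 2 * B * c <= 2 * B * 1 by rewrite ler_wpM2l.
  by apply: ler_pM => //; [rewrite addr_ge0// mulr_ge0|rewrite lerD].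
have := sqr_ge0 B; nra.
Qed.

Local Open Scope ereal_scope.

Theorem corollary9 (R : realType) (d : measure_display) (T : measurableType d)
    (Tcg : countably_generated T)
    (K : R.-pker T ~> T) (pi nu : probability T R)
    (Krev : reversible K pi) (Klazy : lazy_kernel K)
    (phi_gt0 : 0 < conductance K pi)
    (nu_pi : nu `<< pi) (nu_bounded : 'N[pi]_+oo[density nu pi] < +oo)
    (d' : measure_display) (W : measurableType d') (P : probability W R)
    (X : nat -> {RV P >-> T}) (Xmc : markov_chain X nu K)
    (f : T -> R) (fLoo : f \in Lfun pi +oo)
    (n n0 : nat) (n_ge1 : (1 <= n)%N)
    (n0_ge : lne 'N[pi]_+oo[density nu pi] / conductance K pi ^+ 2
             <= n0%:R%:E) :
  rmse pi X f n n0 <=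
    10%:E / (conductance K pi * (Num.sqrt n%:R)%:E) * 'N[pi]_+oo[EFin \o f].
Proof.
have pi1 : pi setT = 1 by exact: probability_setT.
have nu1 : nu setT = 1 by exact: probability_setT.
have [M NM] : exists M, 'N[pi]_+oo[density nu pi] = M%:E.
  exists (fine 'N[pi]_+oo[density nu pi]); rewrite fineK//.
  by rewrite ge0_fin_numE// Lnorm_ge0.
rewrite NM in n0_ge.
have nuM A : measurable A -> (fine (nu A) <= M * fine (pi A))%R.
  move=> mA; have := le_density_Lnorm nu_pi mA; rewrite NM.
  by rewrite -lee_fin EFinM !fineK ?fin_num_measure.
have M1 : (1 <= M)%R.
  have := nuM setT measurableT.
  by rewrite [X in (fine X <= _)%R]nu1 [X in (_ * fine X)%R]pi1 mulr1.
have M0 : (0 <= M)%R by exact: le_trans M1.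
have /andP[] := fLoo; rewrite !inE => mf Nf.
have [B NB] : exists B, 'N[pi]_+oo[EFin \o f] = B%:E.
  exists (fine 'N[pi]_+oo[EFin \o f]); rewrite fineK//.
  by rewrite ge0_fin_numE// Lnorm_ge0.
have B0 : (0 <= B)%R by rewrite -lee_fin -NB Lnorm_ge0.
have pi_null := ae_le_Lnorm_oo mf NB.
have error_le phi p0 p1 iso := rmse_le_isoperimetric (phi := phi)
  Krev Klazy Xmc M0 nuM mf B0 pi_null n0 p0 p1 iso n_ge1.
have bg := bounded_measurable_centered_truncation pi mf B0.
have g0 := int_centered_truncation pi mf B0.
have gL2 := L2norm_centered_truncation pi mf B0.
set s := L2norm pi _ in gL2 error_le.
have s0 : (0 <= s)%R by exact: L2norm_ge0.
(* If f is constant almost everywhere the error vanishes, whatever n0 is; the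
   conductance may then be infinite, so a smaller finite constant is used. *)
have [s_eq0|s_neq0] := eqVneq s 0%R.
  have [phi [p0 p1 phi_le]] : exists phi : R,
      [/\ (0 < phi)%R, (phi <= 1)%R & phi%:E <= conductance K pi].
    case: (conductance K pi) phi_gt0 => [c||]//=.
      rewrite lte_fin => c0; exists (Num.min c 1%R).
      by rewrite lt_min c0 ltr01 lee_fin !ge_min !lexx orbT.
    by move=> _; exists 1%R; rewrite ltr01 lexx leey.
  have p2 : (phi ^+ 2 / 2 <= 1)%R by nra.
  apply: le_trans (error_le phi p0 p2 (conductance_isoperimetric (ltW p0) phi_le)) _.
  rewrite s_eq0 mul0r mulr0 mul0r sqrtr0.
  by rewrite !mule_ge0 ?inve_ge0 ?mule_ge0 ?Lnorm_ge0 ?lee_fin ?sqrtr_ge0// ltW.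
have gap phi : (0 < phi)%R -> phi%:E <= conductance K pi -> (phi ^+ 2 / 2 <= 1)%R.
  move=> p0 /(conductance_isoperimetric (ltW p0)) iso.
  exact: (isoperimetric_constant_le Krev Klazy p0 iso bg g0 s_neq0).
(* Otherwise an infinite conductance would allow phi = 2, against gap. *)
have [phi phiE] : exists phi, conductance K pi = phi%:E.
  case: (conductance K pi) phi_gt0 gap => [c||]// _ gap; first by exists c.
  by have := gap 2%R (ltr0n _ 2) (leey _); rewrite expr2 mulfK// lern1.
rewrite phiE in phi_gt0 n0_ge *.
have p0 : (0 < phi)%R by rewrite -lte_fin.
have phi_le : phi%:E <= conductance K pi by rewrite phiE.
have p1 := gap _ p0 phi_le.
have n0_ge' : (ln M / phi ^+ 2 <= n0%:R)%R.
  move: n0_ge; rewrite lne_EFin ?(lt_le_trans ltr01)//.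
  by rewrite -EFin_expe inver gt_eqF ?exprn_gt0// -EFinM lee_fin.
apply: le_trans (error_le phi p0 p1 (conductance_isoperimetric (ltW p0) phi_le)) _.
have sqn0 : (0 < Num.sqrt n%:R :> R)%R by rewrite sqrtr_gt0 ltr0n.
rewrite NB -EFinM inver gt_eqF ?mulr_gt0// -!EFinM lee_fin.
apply: error_constant_le => //; first by rewrite s0.
rewrite power_gap_le// andbT.
by rewrite mulr_ge0 ?sqrtr_ge0// exprn_ge0// subr_ge0.
Qed.
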